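(* Let $\Omega\subset\mathbb{R}$ be a bounded open interval, $b\in\mathbb{R}\setminus\{0\}$ constant, $f\in L_2(\Omega)$, and $\mathcal{T}_h$ a mesh of $\Omega$. Let $u\in L_2(\Omega)$ be the solution of $-(u,b\nabla v)=(f,v)$ for all $v\in H^1_+(\Omega)$, and let $u_h\in\mathcal{P}^k(\mathcal{T}_h)$, $k\ge 0$, be its approximation, satisfying $$(f,\psi_a)_{\omega_a}+(u_h,b\nabla\psi_a)_{\omega_a}=0\qquad\forall\,a\in\mathcal{V}_h^{\mathrm{int}}\cup\mathcal{V}_h^{\partial_-\Omega}.$$ Let $k'\ge k$ and let $s_h=\sum_{a\in\mathcal{V}_h}\psi_a s_h^a$, where for each $a\in\mathcal{V}_h$, $s_h^a\in\mathcal{P}^{k'}(\mathcal{T}_a)\cap H^1(\omega_a)$ is the solution of $$(b\nabla(\psi_a s_h^a),v_h)_{\omega_a}=(f\psi_a+(b\nabla\psi_a)u_h,\,v_h)_{\omega_a}\qquad\forall\,v_h\in\mathcal{P}^{k'}(\mathcal{T}_a).$$ Assume in addition that $\psi_a f|_{\omega_a}\in\mathcal{P}^{k'}(\mathcal{T}_a)$ for all $a\in\mathcal{V}_h$. Then $$\|u_h-s_h\|\le 2\,C_{\mathrm{cont,PF}}\,\|u-u_h\|.$$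
   Context: Notation: $(v,w)_D=\int_D vw$, $\|v\|_D=(v,v)_D^{1/2}$, with the subscript dropped when $D=\Omega$; $\nabla v=v'$. For an open interval $D$ with outward unit normal $n=\pm1$ at its endpoints, $\partial_\pm D=\{x\in\partial D:\pm b\,n(x)>0\}$ ($-$ inflow, $+$ outflow) and $H^1_\pm(D)=\{w\in H^1(D): w=0\text{ on }\partial_\pm D\}$. Mesh: $\mathcal{T}_h$ is a finite division of $\Omega$ into non-overlapping intervals covering $\Omega$, shape regular in the sense that any two neighboring intervals have comparable lengths up to a constant $\kappa_{\mathcal{T}_h}$. The set of vertices is $\mathcal{V}_h=\mathcal{V}_h^{\mathrm{int}}\cup\mathcal{V}_h^{\partial_-\Omega}\cup\mathcal{V}_h^{\partial_+\Omega}$ (interior, inflow and outflow vertices). For $a\in\mathcal{V}_h$, $\mathcal{T}_a$ is the set of elements having $a$ as a vertex, $\omega_a$ the corresponding open interval, $h_{\omega_a}$ its diameter, and $\psi_a$ the continuous piecewise affine hat function equal to $1$ at $a$ and $0$ at all other vertices. $\mathcal{P}^{m}(\mathcal{T})$ denotes piecewise polynomials of degree at most $m$ on $\mathcal{T}$ (no continuity imposed). The local solutions $s_h^a$ exist and are unique; products $\psi_a s_h^a$ are extended by zero outside $\omega_a$. Constant: let $H^1_*(\omega_a)=\{v\in H^1(\omega_a):(v,1)_{\omega_a}=0\}$ if $a\notin\mathcal{V}_h^{\partial_+\Omega}$ and $H^1_*(\omega_a)=H^1_+(\omega_a)$ if $a\in\mathcal{V}_h^{\partial_+\Omega}$. $C_{\mathrm{PF},\omega_a}>0$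 is a constant in the Poincaré(–Friedrichs) inequality $\|v\|_{\omega_a}\le h_{\omega_a}C_{\mathrm{PF},\omega_a}\|\nabla v\|_{\omega_a}$ for all $v\in H^1_*(\omega_a)$ (for an interval it can be taken equal to $1$), and $$C_{\mathrm{cont,PF}}=\max_{a\in\mathcal{V}_h}\bigl(1+C_{\mathrm{PF},\omega_a}h_{\omega_a}\|\nabla\psi_a\|_\infty\bigr),$$ which only depends on the shape regularity of the mesh. *)

(* Defs.v *)
From HB Require Import structures.
From mathcomp Require Import all_boot all_order all_algebra.
From mathcomp Require Import all_classical all_reals all_analysis.
Set Implicit Arguments.
Unset Strict Implicit.
Unset Printing Implicit Defensive.
Import Order.TTheory GRing.Theory Num.Theory.
Import numFieldNormedType.Exports.
Local Open Scope classical_set_scope.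
Local Open Scope ring_scope.

(* Elements of L_2(D), H^1(D), ... are represented by functions R -> R, of which
   only the restriction to D matters, up to Lebesgue-null sets. *)
Section FunctionSpaces.
Context {R : realType}.
Implicit Types (D K : set R) (v w g phi : R -> R) (b c d x : R).

Local Notation mu := (@lebesgue_measure R).

Definition L2 D : set (R -> R) := [set v | v \_ D \in Lfun mu 2%:E].

Definition inner D v w : R := \int[mu]_(x in D) (v x * w x).

Definition norm2 D v : R := Num.sqrt (inner D v v).

Definition normoo D v : R := fine 'N[mu]_(+oo)[EFin \o (v \_ D)]%E.

(* C^1_c(D), for D open; the usual class of test functions in dimension one
   (e.g. Brezis, Functional Analysis, Sobolev Spaces and PDEs, Section 8.2). *)
Definition C1c D : set (R -> R) :=
  [set phi : R -> R | [/\ forall x, derivable phi x 1,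
                          continuous (derive1 phi) &
                          exists K, [/\ compact K, K `<=` D &
                                        forall x, ~ K x -> phi x = 0]]].

Definition weak_derivative D v g : Prop :=
  forall phi, C1c D phi -> inner D v (derive1 phi) = - inner D g phi.

Definition H1 D : set (R -> R) :=
  [set v | L2 D v /\ exists g, L2 D g /\ weak_derivative D v g].

(* A square-integrable weak derivative of v on D, which is unique up to null
   sets; the value is meaningful only if v belongs to H1 D. *)
Definition grad D v : R -> R :=
  xget (cst 0) [set g | L2 D g /\ weak_derivative D v g].

(* Boundary of ]c, d[: outward unit normal, inflow and outflow parts. *)
Definition normal c d x : R := if x == c then -1 else 1.

Definition inflow b c d : set R :=
  [set x | (x = c \/ x = d) /\ 0 < - b * normal c d x].

Definition outflow b c d : set R :=
  [set x | (x = c \/ x = d) /\ 0 < b * normal c d x].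

(* The boundary values of an H^1 function on ]c, d[ are those of its
   representative that is continuous on [c, d]. *)
Definition vanishes_on c d (B : set R) v : Prop :=
  exists w, [/\ {within `[c, d], continuous w},
                v = w %[ae mu in `]c, d[%classic] &
                forall x, B x -> w x = 0].

Definition H1_outflow b c d : set (R -> R) :=
  [set v | H1 `]c, d[ v /\ vanishes_on c d (outflow b c d) v].

End FunctionSpaces.

(* Mesh of ]l, r[ with mesh_size elements ]vertex i, vertex i.+1[,
   i < mesh_size; only the values vertex i with i <= mesh_size are relevant. *)
Record mesh (R : realType) (l r kappa : R) := Mesh {
  mesh_size : nat;
  vertex : nat -> R;
  mesh_size_gt0 : (0 < mesh_size)%N;
  vertex_first : vertex 0 = l;
  vertex_last : vertex mesh_size = r;
  vertex_lt : forall i, (i < mesh_size)%N -> vertex i < vertex i.+1;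
  mesh_regular : forall i, (i.+1 < mesh_size)%N ->
    vertex i.+1 - vertex i <= kappa * (vertex i.+2 - vertex i.+1) /\
    vertex i.+2 - vertex i.+1 <= kappa * (vertex i.+1 - vertex i)
}.

Section Mesh.
Context {R : realType} {l r kappa : R} (T : mesh l r kappa).
Implicit Types (a i k : nat) (b : R) (v : R -> R) (E : set nat).

Local Notation mu := (@lebesgue_measure R).
Local Notation N := (mesh_size T).
Local Notation x := (vertex T).

Definition element i : set R := `]x i, x i.+1[.

(* T_h and T_a, as sets of element indices. *)
Definition elements : set nat := [set i | (i < N)%N].

Definition elements_at a : set nat :=
  [set i | (i < N)%N /\ (i = a \/ i.+1 = a)].

Definition pw_poly E k : set (R -> R) :=
  [set v | forall i, E i ->
     measurable_fun (element i) v /\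
     exists p : {poly R}, (size p <= k.+1)%N /\
       v = (fun y => p.[y]) %[ae mu in element i]].

Definition interior_vertex a : Prop := (0 < a < N)%N.
Definition inflow_vertex b a : Prop := inflow b l r (x a).
Definition outflow_vertex b a : Prop := outflow b l r (x a).

(* omega_a; at the first and last vertex it is a single element, since
   0.-1 = 0 and minn N.+1 N = N. *)
Definition patch_left a : R := x a.-1.
Definition patch_right a : R := x (minn a.+1 N).
Definition omega a : set R := `]patch_left a, patch_right a[.
Definition patch_diam a : R := patch_right a - patch_left a.

Definition hat a : R -> R := fun y =>
  if (0 < a)%N && (x a.-1 <= y <= x a) then (y - x a.-1) / (x a - x a.-1)
  else if (a < N)%N && (x a <= y <= x a.+1) then (x a.+1 - y) / (x a.+1 - x a)
  else 0.

Definition H1_star b a : set (R -> R) :=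
  [set v | (~ outflow_vertex b a ->
              H1 (omega a) v /\ inner (omega a) v (cst 1) = 0) /\
           (outflow_vertex b a ->
              H1_outflow b (patch_left a) (patch_right a) v)].

Definition PF_constant b a (C : R) : Prop :=
  0 < C /\
  forall v, H1_star b a v ->
    norm2 (omega a) v <= patch_diam a * C * norm2 (omega a) (grad (omega a) v).

(* The terms are all at least 1, so the neutral element 0 plays no role. *)
Definition C_contPF (CPF : 'I_N.+1 -> R) : R :=
  \big[Num.max/0]_(a < N.+1)
    (1 + CPF a * patch_diam a * normoo (omega a) (grad (omega a) (hat a))).

Definition reconstruction (s : 'I_N.+1 -> R -> R) : R -> R :=
  fun y => \sum_(a < N.+1) ((hat a \* s a) \_ (omega a)) y.

End Mesh.

(* Main.v *)
Require Import Defs.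
From HB Require Import structures.
From mathcomp Require Import all_boot all_order all_algebra.
From mathcomp Require Import all_classical all_reals all_analysis.
From mathcomp Require Import measurable_realfun ess_sup_inf zify ring lra.
Import Order.TTheory GRing.Theory Num.Theory.
Import numFieldNormedType.Exports.
Local Open Scope classical_set_scope.
Local Open Scope ring_scope.

(** The hat functions form a partition of unity, so that u_h - s_h is the sum of
    the patch contributions w_a = psi_a (u_h - s_a). Only two of them overlap on
    each element, whence
      norm (u_h - s_h)^2 <= 2 sum_a norm (w_a)^2,
    the norm of w_a being taken on the patch omega_a. It is enough to show that
    norm w_a <= K norm (u - u_h) on omega_a, K being the maximal patch constant:
    each element belongs to two patches, which gives the second factor 2 under
    the square root ([sum_patches]).

    On a patch, write w = w_a = b v'. Integrating by parts, inserting the local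
    problem for s_a and then the equation for u tested with psi_a v, one gets
      norm w ^2 = (u_h - u, b (psi_a v)')
    ([energy_identity]). This needs the local problem to hold pointwise almost
    everywhere, which is true because both of its sides are piecewise polynomials
    in the test space ([strong_local_equation]), and the boundary terms
    psi_a s_a v to vanish. The latter is clear where psi_a vanishes; at an inflow
    vertex, s_a = 0 by the orthogonality assumed on u_h, and at an outflow vertex
    v = 0 by choice of the primitive. Elsewhere the primitive v is chosen with
    mean value 0, so that the Poincare-Friedrichs inequality bounds (psi_a v)' by
    v' = w / b, and one factor norm w cancels ([patch_estimate]).

    All functions involved except u are piecewise polynomials, so no general
    theory of H^1 is used: [splice] represents them on a patch, and integration
    by parts is [inner_splice_C1]. Two facts link them to weak derivatives. Weak
    derivatives are unique up to null sets, by the fundamental lemma of the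
    calculus of variations ([orthogonal_C1c_eq0]); hence grad is the elementwise
    derivative of a continuous piecewise polynomial. Conversely a piecewise
    polynomial in H^1 has no jump at the vertex ([H1_no_jump]), which makes
    psi_a s_a continuous. *)

Set Implicit Arguments.
Unset Strict Implicit.
Unset Printing Implicit Defensive.


(** * Square-integrable functions *)

Section SquareIntegrable.
Context {R : realType}.
Implicit Types (D : set R) (f g h : R -> R).
Local Notation mu := (@lebesgue_measure R).

Lemma ae_imply (P Q : R -> Prop) : (forall x, P x -> Q x) ->
  (\forall x \ae mu, P x) -> \forall x \ae mu, Q x.
Proof. by apply: filterS; exact: (ae_filter_ringOfSetsType mu). Qed.

Lemma ae_imply2 (P Q S : R -> Prop) : (forall x, P x -> Q x -> S x) ->
  (\forall x \ae mu, P x) -> (\forall x \ae mu, Q x) -> \forall x \ae mu, S x.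
Proof. by apply: filterS2; exact: (ae_filter_ringOfSetsType mu). Qed.

Lemma integrable_le D f g : measurable D -> measurable_fun D f ->
  (forall x, D x -> `|f x| <= g x) ->
  mu.-integrable D (fun x => (g x)%:E) -> mu.-integrable D (fun x => (f x)%:E).
Proof.
move=> mD mf fg; apply: le_integrable => //; first exact/measurable_EFinP.
by move=> x Dx; rewrite /= lee_fin (le_trans (fg _ Dx))// ler_norm.
Qed.

Lemma L2_measurable D f : measurable D -> L2 D f -> measurable_fun D f.
Proof.
move=> mD; rewrite /L2 /= inE => /andP[/[!inE]/= mf _].
exact: (measurable_restrictT f mD).2 mf.
Qed.

Lemma L2_integrable_sqr D f : measurable D -> L2 D f ->
  mu.-integrable D (EFin \o (fun x => f x ^+ 2)).
Proof.
move=> mD /Lfun2_integrable_sqr i2.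
have /= -> := @integrable_mkcond _ _ _ mu D (EFin \o (fun x => f x ^+ 2)) mD.
move: i2.
apply: eq_integrable => // x _.
by rewrite restrict_EFin /= !patchE; case: ifP => //; rewrite expr0n.
Qed.

Lemma L2I D f : measurable D -> measurable_fun D f ->
  mu.-integrable D (EFin \o (fun x => f x ^+ 2)) -> L2 D f.
Proof.
move=> mD mf /integrableP[_ foo]; rewrite /L2 /= inE; apply/andP; split.
  by rewrite inE /=; exact: (measurable_restrictT f mD).1 mf.
rewrite inE /= /finite_norm unlock poweR_lty//.
apply: le_lt_trans foo; rewrite [leRHS]integral_mkcond le_eqVlt.
apply/orP; left; apply/eqP; apply: eq_integral => x _.
rewrite /= !patchE; case: ifP => _ /=.
  by rewrite powR_mulrn// normrX.
by rewrite normr0 powR0.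
Qed.

Lemma eq_L2 D f g : {in D, f =1 g} -> L2 D f -> L2 D g.
Proof.
move=> fg; rewrite /L2 /=; suff -> : f \_ D = g \_ D by [].
by apply/funext => x; rewrite !patchE; case: ifPn => // /fg.
Qed.

Lemma L2_le D f g : measurable D -> measurable_fun D g ->
  (forall x, D x -> `|g x| <= `|f x|) -> L2 D f -> L2 D g.
Proof.
move=> mD mg gf lf; apply: L2I => //.
apply: le_integrable (L2_integrable_sqr mD lf) => //.
  by apply/measurable_EFinP; exact: measurable_funX.
by move=> x Dx; rewrite /= lee_fin !normrX lerXn2r// ?nnegrE// gf.
Qed.

Lemma L2_mul_integrable D f g : measurable D -> L2 D f -> L2 D g ->
  mu.-integrable D (EFin \o (fun x => f x * g x)).
Proof.
move=> mD lf lg.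
have iS := @integrableD _ _ _ mu _ mD _ _ (L2_integrable_sqr mD lf) (L2_integrable_sqr mD lg).
apply: le_integrable iS => //.
  by apply/measurable_EFinP; apply: measurable_funM; exact: L2_measurable.
move=> x Dx; rewrite /= lee_fin [leRHS]ger0_norm; last first.
  by rewrite addr_ge0// sqr_ge0.
by rewrite normrM -(real_normK (num_real (f x))) -(real_normK (num_real (g x)));
  have := sqr_ge0 (`|f x| - `|g x|); have := sqr_ge0 (`|f x| + `|g x|); nra.
Qed.

Lemma L2D D f g : measurable D -> L2 D f -> L2 D g -> L2 D (fun x => f x + g x).
Proof.
move=> mD lf lg.
have iS := @integrableD _ _ _ mu _ mD _ _ (L2_integrable_sqr mD lf) (L2_integrable_sqr mD lg).
have mfg : measurable_fun D (fun x => f x + g x).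
  by apply: measurable_funD; exact: L2_measurable.
apply: L2I => //.
have iS2 := @integrableD _ _ _ mu _ mD _ _ iS iS.
apply: integrable_le iS2 => //; first exact: measurable_funX.
move=> x Dx; rewrite /= ger0_norm ?sqr_ge0//.
by have := sqr_ge0 (f x - g x); nra.
Qed.

Lemma L2Z D f k : measurable D -> L2 D f -> L2 D (fun x => k * f x).
Proof.
move=> mD lf; apply: L2I => //.
  by apply: measurable_funM => //; exact: L2_measurable.
have := @integrableZl _ _ _ mu _ mD (k ^+ 2) _ (L2_integrable_sqr mD lf).
by apply: eq_integrable => // x _ /=; rewrite -EFinM exprMn.
Qed.

Lemma L2B D f g : measurable D -> L2 D f -> L2 D g -> L2 D (fun x => f x - g x).
Proof.
move=> mD lf /(L2Z (-1) mD) lg; apply: eq_L2 (L2D mD lf lg) => x _ /=.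
by rewrite mulN1r.
Qed.

Lemma L2S D E f : measurable D -> measurable E -> E `<=` D -> L2 D f -> L2 E f.
Proof.
move=> mD mE ED lf; apply: L2I => //.
  exact: measurable_funS (L2_measurable mD lf).
exact: integrableS (L2_integrable_sqr mD lf).
Qed.

(** Measurability has to be assumed: Lebesgue measure is taken on Borel sets, so
    a function equal almost everywhere to a measurable one need not be
    measurable. *)
Lemma L2_ae D f g : measurable D -> measurable_fun D f ->
  f = g %[ae mu in D] -> L2 D g -> L2 D f.
Proof.
move=> mD mf fg lg; apply: L2I => //.
have /integrableP[mg2 ioo] := L2_integrable_sqr mD lg.
have mf2 : measurable_fun D (fun x => (f x ^+ 2)%:E).
  by apply/measurable_EFinP; exact: measurable_funX.
apply/integrableP; split => //; apply: le_lt_trans ioo.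
rewrite le_eqVlt; apply/orP; left; apply/eqP; apply: ae_eq_integral => //.
- exact: measurableT_comp.
- exact: measurableT_comp.
by apply: ae_imply fg => x fg Dx /=; rewrite fg.
Qed.

Lemma L2_continuous (c d : R) f : continuous f -> L2 `]c, d[ f.
Proof.
move=> cf; apply: L2I => //.
  apply: measurable_funTS; exact: continuous_measurable_fun.
have cf2 : continuous (fun x => f x ^+ 2).
  rewrite (_ : (fun x => f x ^+ 2) = fun x => f x * f x) => [x|].
    by apply: continuousM; exact: cf.
  by apply/funext => y; rewrite expr2.
have : mu.-integrable `[c, d] (EFin \o (fun x => f x ^+ 2)).
  apply: continuous_compact_integrable; first exact: segment_compact.
  apply: continuous_subspaceT => x.
  exact: cf2.
apply: integrableS => //; exact: subset_itv_oo_cc.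
Qed.

Lemma Rintegral_ae D f g : measurable D ->
  measurable_fun D f -> measurable_fun D g -> f = g %[ae mu in D] ->
  \int[mu]_(x in D) f x = \int[mu]_(x in D) g x.
Proof.
move=> mD mf mg fg; congr fine; apply: ae_eq_integral => //.
- exact/measurable_EFinP.
- exact/measurable_EFinP.
- by apply: ae_imply fg => x fg Dx /=; rewrite fg.
Qed.

Lemma inner_ae D f1 f2 g1 g2 : measurable D ->
  L2 D f1 -> L2 D f2 -> L2 D g1 -> L2 D g2 ->
  f1 = f2 %[ae mu in D] -> g1 = g2 %[ae mu in D] ->
  inner D f1 g1 = inner D f2 g2.
Proof.
move=> mD lf1 lf2 lg1 lg2 f12 g12; apply: Rintegral_ae => //.
- by apply: measurable_funM; exact: L2_measurable.
- by apply: measurable_funM; exact: L2_measurable.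
by apply: ae_imply2 f12 g12 => x f12 g12 Dx /=; rewrite f12// g12.
Qed.

Lemma norm2_ae D f g : measurable D -> L2 D f -> L2 D g ->
  f = g %[ae mu in D] -> norm2 D f = norm2 D g.
Proof. by move=> mD lf lg fg; rewrite /norm2 (inner_ae mD lf lg lf lg). Qed.

Lemma innerC D f g : inner D f g = inner D g f.
Proof. by apply: eq_Rintegral => x _; rewrite mulrC. Qed.

Lemma eq_inner D f1 f2 g1 g2 : {in D, f1 =1 f2} -> {in D, g1 =1 g2} ->
  inner D f1 g1 = inner D f2 g2.
Proof. by move=> f12 g12; apply: eq_Rintegral => x xD; rewrite f12// g12. Qed.

Lemma innerDl D f g h : measurable D -> L2 D f -> L2 D g -> L2 D h ->
  inner D (fun x => f x + g x) h = inner D f h + inner D g h.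
Proof.
move=> mD lf lg lh.
rewrite /inner -RintegralD//; try exact: L2_mul_integrable.
by apply: eq_Rintegral => x _; rewrite mulrDl.
Qed.

Lemma innerZl D f h k : measurable D -> L2 D f -> L2 D h ->
  inner D (fun x => k * f x) h = k * inner D f h.
Proof.
move=> mD lf lh; rewrite /inner -RintegralZl//; last exact: L2_mul_integrable.
by apply: eq_Rintegral => x _; rewrite mulrA.
Qed.

Lemma innerBl D f g h : measurable D -> L2 D f -> L2 D g -> L2 D h ->
  inner D (fun x => f x - g x) h = inner D f h - inner D g h.
Proof.
move=> mD lf lg lh.
rewrite /inner -RintegralB//; try exact: L2_mul_integrable.
by apply: eq_Rintegral => x _; rewrite mulrBl.
Qed.

Lemma innerZr D f h k : measurable D -> L2 D f -> L2 D h ->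
  inner D h (fun x => k * f x) = k * inner D h f.
Proof. by move=> mD lf lh; rewrite innerC innerZl// innerC. Qed.

Lemma innerDr D f g h : measurable D -> L2 D f -> L2 D g -> L2 D h ->
  inner D h (fun x => f x + g x) = inner D h f + inner D h g.
Proof. by move=> mD lf lg lh; rewrite innerC innerDl// !(innerC D h). Qed.

Lemma innerBr D f g h : measurable D -> L2 D f -> L2 D g -> L2 D h ->
  inner D h (fun x => f x - g x) = inner D h f - inner D h g.
Proof. by move=> mD lf lg lh; rewrite innerC innerBl// !(innerC D h). Qed.

Lemma inner_ge0 D f : 0 <= inner D f f.
Proof. by apply: Rintegral_ge0 => x _; rewrite -expr2 sqr_ge0. Qed.

Lemma norm2_ge0 D f : 0 <= norm2 D f.
Proof. exact: sqrtr_ge0. Qed.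

Lemma norm2_sqr D f : norm2 D f ^+ 2 = inner D f f.
Proof. by rewrite sqr_sqrtr// inner_ge0. Qed.

Lemma norm2Z D f k : measurable D -> L2 D f ->
  norm2 D (fun x => k * f x) = `|k| * norm2 D f.
Proof.
move=> mD lf; rewrite /norm2 innerZl//; last exact: L2Z.
rewrite innerZr// mulrA -expr2 sqrtrM ?sqr_ge0//.
by rewrite sqrtr_sqr.
Qed.

(** The square of the norm of s f - t g is nonnegative for all s and t; for
    nonzero norms, s := norm2 D g and t := norm2 D f give the bound. *)
Lemma cauchy_schwarz D f g : measurable D -> L2 D f -> L2 D g ->
  inner D f g <= norm2 D f * norm2 D g.
Proof.
move=> mD lf lg.
have key s t : 2 * s * t * inner D f g <=
    s ^+ 2 * norm2 D f ^+ 2 + t ^+ 2 * norm2 D g ^+ 2.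
  rewrite !norm2_sqr -subr_ge0.
  have lsf := L2Z s mD lf; have ltg := L2Z t mD lg; have := L2B mD lsf ltg => lB.
  suff <- : inner D (fun x => s * f x - t * g x) (fun x => s * f x - t * g x) =
    s ^+ 2 * inner D f f + t ^+ 2 * inner D g g - 2 * s * t * inner D f g.
    exact: inner_ge0.
  by rewrite innerBl// !innerBr// !innerZl// !innerZr// (innerC _ g f); ring.
have [f0|f0] := eqVneq (norm2 D f) 0.
  rewrite f0 mul0r leNgt; apply/negP => I0.
  (* for f of norm 0 the quadratic inequality is affine in s, and this value of
     s violates it as soon as the inner product is positive *)
  have := key ((norm2 D g ^+ 2 + 1) / (2 * inner D f g)) 1.
  rewrite f0 expr0n mulr0 add0r expr1n mul1r mulr1.
  have -> : 2 * ((norm2 D g ^+ 2 + 1) / (2 * inner D f g)) * inner D f g =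
    norm2 D g ^+ 2 + 1 by field; lra.
  by lra.
have {}f0 : 0 < norm2 D f by rewrite lt_neqAle eq_sym f0 norm2_ge0.
have [g0|g0] := eqVneq (norm2 D g) 0.
  rewrite g0 mulr0 leNgt; apply/negP => I0.
  have := key 1 ((norm2 D f ^+ 2 + 1) / (2 * inner D f g)).
  rewrite g0 expr0n mulr0 addr0 expr1n mul1r mulr1.
  have -> : 2 * ((norm2 D f ^+ 2 + 1) / (2 * inner D f g)) * inner D f g =
    norm2 D f ^+ 2 + 1 by field; lra.
  by lra.
have {}g0 : 0 < norm2 D g by rewrite lt_neqAle eq_sym g0 norm2_ge0.
have := key (norm2 D g) (norm2 D f).
have h : 0 < 2 * norm2 D g * norm2 D f by rewrite !mulr_gt0.
move=> k1; rewrite -(ler_pM2l h); apply: (le_trans k1); rewrite le_eqVlt.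
by apply/orP; left; apply/eqP; ring.
Qed.

Lemma norm2_triangle D f g : measurable D -> L2 D f -> L2 D g ->
  norm2 D (fun x => f x + g x) <= norm2 D f + norm2 D g.
Proof.
move=> mD lf lg; have lD := L2D mD lf lg.
rewrite -ler_sqr ?nnegrE ?addr_ge0 ?norm2_ge0//.
rewrite norm2_sqr innerDl// !innerDr//.
rewrite sqrrD !norm2_sqr (innerC D g f) addrA [leRHS]addrAC -!addrA lerD2l.
have := cauchy_schwarz mD lf lg; rewrite mulr2n.
lra.
Qed.

Lemma norm2_le_ae D f g (k : R) : measurable D -> L2 D f -> L2 D g -> 0 <= k ->
  (\forall x \ae mu, D x -> `|f x| <= k * `|g x|) ->
  norm2 D f <= k * norm2 D g.
Proof.
move=> mD lf lg k0 fg; rewrite -(ger0_norm k0) -norm2Z//.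
apply: ler_wsqrtr; have lkg := L2Z k mD lg.
apply: fine_le.
- exact/integrable_fin_num/L2_mul_integrable.
- exact/integrable_fin_num/L2_mul_integrable.
apply: ae_ge0_le_integral => //.
- by move=> x _; rewrite lee_fin -expr2 sqr_ge0.
- exact: measurable_int (L2_mul_integrable mD lf lf).
- by move=> x _; rewrite lee_fin -expr2 sqr_ge0.
- exact: measurable_int (L2_mul_integrable mD lkg lkg).
apply: ae_imply fg => x fg Dx; rewrite lee_fin -!expr2.
rewrite -(real_normK (num_real (f x))) -(real_normK (num_real (k * g x))).
by rewrite lerXn2r ?nnegrE// normrM (ger0_norm k0) fg.
Qed.

Lemma inner_eq0_ae D f : measurable D -> L2 D f -> inner D f f = 0 ->
  f = cst 0 %[ae mu in D].
Proof.
move=> mD lf If.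
have i2 := L2_integrable_sqr mD lf.
have m2 : measurable_fun D (fun x => (f x ^+ 2)%:E) := measurable_int _ i2.
suff /(ae_eq_integral_abs mu mD m2) : (\int[mu]_(x in D) `|(f x ^+ 2)%:E| = 0)%E.
  by apply: ae_imply => x h /h /= [] /eqP; rewrite sqrf_eq0 => /eqP.

rewrite -(fineK (@integrable_fin_num _ _ _ mu _ mD _ (integrable_abse i2))).
congr EFin; rewrite -{}If; congr fine; apply: eq_integral => x _ /=.
by rewrite ger0_norm ?sqr_ge0// expr2.
Qed.

Lemma itv_split (c m d : R) : c < m -> m < d ->
  `]c, d[%classic = (`]c, m[ `|` [set m]) `|` `]m, d[ :> set R.
Proof.
move=> cm md; apply/seteqP; split => x /=; rewrite !in_itv /=.
  move=> /andP[cx xd]; case: (ltgtP x m) => [xm|mx|->]; rewrite ?cx ?xd.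
  - by left; left.
  - by right.
  - by left; right.
by move=> [[/andP[cx xm]|->]|/andP[mx xd]]; lra.
Qed.

Lemma L2_split (c m d : R) f : c <= m -> m <= d ->
  L2 `]c, m[ f -> L2 `]m, d[ f -> L2 `]c, d[ f.
Proof.
rewrite le_eqVlt => /predU1P[<-//|cm]; rewrite le_eqVlt => /predU1P[<-//|md].
move=> lf1 lf2; rewrite (itv_split cm md).
have mU h : measurable_fun `]c, m[ h -> measurable_fun `]m, d[ h ->
    measurable_fun ((`]c, m[ `|` [set m]) `|` `]m, d[ : set R) (h : R -> R).
  move=> m1 m2; apply/measurable_funU => //; first exact: measurableU.
  split=> //; apply/measurable_funU => //; split=> //; exact: measurable_fun_set1.
have mD : measurable ((`]c, m[ `|` [set m]) `|` `]m, d[ : set R).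
  by do 2 apply: measurableU => //.
have mf : measurable_fun ((`]c, m[ `|` [set m]) `|` `]m, d[ : set R) f.
  by apply: mU; exact: L2_measurable.
apply: L2I => //; apply/integrableP; split.
  by apply/measurable_EFinP; exact: measurable_funX.
have m2 : measurable_fun ((`]c, m[ `|` [set m]) `|` `]m, d[ : set R)
    (fun x => `|(f x ^+ 2)%:E|%E).
  by apply: measurableT_comp => //; apply/measurable_EFinP; exact: measurable_funX.
have m3 : measurable (`]c, m[ `|` [set m] : set R) by exact: measurableU.
rewrite ge0_integral_setU//; last first.
  by apply/disj_setPS => x [] /=; rewrite !in_itv/= => -[/andP[? ?]|->] /andP[? ?]; lra.
rewrite ge0_integral_setU//; last 2 first.
- exact: measurable_funS m2.
- by apply/disj_setPS => x [] /=; rewrite !in_itv/= => /andP[? ?] ?; lra.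
rewrite integral_set1 adde0.
have /integrableP[_ h1] := L2_integrable_sqr (measurable_itv _) lf1.
have /integrableP[_ h2] := L2_integrable_sqr (measurable_itv _) lf2.
by rewrite lte_add_pinfty.
Qed.

Lemma Rintegral_split (c m d : R) f : c <= m -> m <= d ->
  mu.-integrable `]c, d[ (EFin \o f) ->
  \int[mu]_(x in `]c, d[) f x =
  \int[mu]_(x in `]c, m[) f x + \int[mu]_(x in `]m, d[) f x.
Proof.
rewrite le_eqVlt => /predU1P[<-|cm].
  by move=> _ _; rewrite set_itvoo0 ?Rintegral_set0 ?add0r// -leNgt.
rewrite le_eqVlt => /predU1P[<-|md].
  by move=> _; rewrite set_itvoo0 ?Rintegral_set0 ?addr0// -leNgt.
rewrite (itv_split cm md) => fi.
have m3 : measurable (`]c, m[ `|` [set m] : set R) by exact: measurableU.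
rewrite Rintegral_setU//; last first.
  by apply/disj_setPS => x [] /=; rewrite !in_itv/= => -[/andP[? ?]|->] /andP[? ?]; lra.
rewrite Rintegral_setU//; last 2 first.
- by apply: integrableS fi => //; exact: measurableU.
- by apply/disj_setPS => x [] /=; rewrite !in_itv/= => /andP[? ?] ?; lra.
by rewrite Rintegral_set1 addr0.
Qed.

Lemma inner_split (c m d : R) f g : c <= m -> m <= d ->
  L2 `]c, d[ f -> L2 `]c, d[ g ->
  inner `]c, d[ f g = inner `]c, m[ f g + inner `]m, d[ f g.
Proof.
by move=> cm md lf lg; apply: Rintegral_split => //; exact: L2_mul_integrable.
Qed.

End SquareIntegrable.


(** * Functions of class C^1 *)

Section ContinuouslyDifferentiable.
Context {R : realType}.
Implicit Types (f g phi dphi : R -> R) (p q : {poly R}).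
Local Notation mu := (@lebesgue_measure R).

(** The derivative is a parameter, so that composite functions come with an
    explicit derivative instead of a value of derive1 to be computed. *)
Definition C1_with phi dphi :=
  (forall x, is_derive x (1 : R) phi (dphi x)) /\ continuous dphi.

Lemma derive1_C1 phi dphi : C1_with phi dphi -> phi^`()%classic = dphi.
Proof. by move=> [d _]; apply/funext => x; rewrite derive1E; exact: derive_val. Qed.

Lemma continuous_C1 phi dphi : C1_with phi dphi -> continuous phi.
Proof.
move=> [d _] x; apply: differentiable_continuous; apply/derivable1_diffP.
exact: ex_derive.
Qed.

Lemma continuous_poly p : continuous (horner p).
Proof.
move=> x; apply: differentiable_continuous; apply/derivable1_diffP.
exact: derivable_horner.
Qed.

Lemma C1_poly p : C1_with (horner p) (horner p^`()).
Proof. by split=> [x|]; [exact: is_derive_poly|exact: continuous_poly]. Qed.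

Lemma C1_mul f df g dg : C1_with f df -> C1_with g dg ->
  C1_with (fun x => f x * g x) (fun x => f x * dg x + df x * g x).
Proof.
move=> Cf Cg; have cf := continuous_C1 Cf; have cg := continuous_C1 Cg.
move: Cf Cg => [f1 f2] [g1 g2]; split=> x.
  have -> : f x * dg x + df x * g x = f x *: dg x + g x *: df x.
    by rewrite /GRing.scale /= (mulrC (df x)).
  exact: is_deriveM.
by apply: (@continuousD _ _ _ (fun x => f x * dg x) (fun x => df x * g x));
  apply: continuousM; [exact: cf|exact: g2|exact: f2|exact: cg].
Qed.

Lemma C1_comp f df g dg : C1_with f df -> C1_with g dg ->
  C1_with (fun x => f (g x)) (fun x => df (g x) * dg x).
Proof.
move=> Cf Cg; have cg := continuous_C1 Cg.
move: Cf Cg => [f1 f2] [g1 g2]; split=> x.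
  exact: is_derive1_comp.
apply: (@continuousM _ _ (df \o g)); last exact: g2.
by apply: continuous_comp; [exact: cg|exact: f2].
Qed.

Lemma Rintegral_C1 c d f df : c <= d -> C1_with f df ->
  \int[mu]_(x in `]c, d[) df x = f d - f c.
Proof.
rewrite le_eqVlt => /predU1P[<- _|cd Cf].
  by rewrite set_itvoo0 ?Rintegral_set0 ?subrr// -leNgt.
have cf := continuous_C1 Cf.
have icd : mu.-integrable `[c, d] (EFin \o df).
  apply: continuous_compact_integrable; first exact: segment_compact.
  by apply: continuous_subspaceT; exact: Cf.2.
have icd' : mu.-integrable `[c, d[ (EFin \o df).
  by apply: integrableS icd => //; exact: subset_itv_co_cc.
have icd'' : mu.-integrable `]c, d[ (EFin \o df).
  by apply: integrableS icd => //; exact: subset_itv_oo_cc.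
rewrite (Rintegral_itv_obnd_cbnd icd'') (Rintegral_itv_bndo_bndc icd').
rewrite /Rintegral (@continuous_FTC2 _ df f) //.
- by apply: continuous_subspaceT; exact: Cf.2.
- split=> [x _||]; first by have [+ _] := Cf; move=> /(_ x)/@ex_derive.
  + by apply: cvg_at_right_filter; exact: cf.
  + by apply: cvg_at_left_filter; exact: cf.
by move=> x _; rewrite (derive1_C1 Cf).
Qed.

End ContinuouslyDifferentiable.

(** * Piecewise polynomials with one breakpoint *)

Section Splice.
Context {R : realType}.
Implicit Types (c d m : R) (f g phi dphi : R -> R) (p q : {poly R}).
Local Notation mu := (@lebesgue_measure R).

(** On a vertex patch every discrete function is of this form, with breakpoint m
    at the vertex. A breakpoint at an end of the interval is allowed, which
    covers the one-element patches of the boundary vertices. *)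
Definition splice m p q : R -> R := fun y => if y <= m then p.[y] else q.[y].

Lemma spliceM m p1 q1 p2 q2 y :
  splice m p1 q1 y * splice m p2 q2 y = splice m (p1 * p2) (q1 * q2) y.
Proof. by rewrite /splice; case: ifP => _; rewrite hornerM. Qed.

Lemma spliceD m p1 q1 p2 q2 y :
  splice m p1 q1 y + splice m p2 q2 y = splice m (p1 + p2) (q1 + q2) y.
Proof. by rewrite /splice; case: ifP => _; rewrite hornerD. Qed.

Lemma spliceB m p1 q1 p2 q2 y :
  splice m p1 q1 y - splice m p2 q2 y = splice m (p1 - p2) (q1 - q2) y.
Proof. by rewrite /splice; case: ifP => _; rewrite hornerD hornerN. Qed.

Lemma spliceZ m k p q y : k * splice m p q y = splice m (k *: p) (k *: q) y.
Proof. by rewrite /splice; case: ifP => _; rewrite hornerZ. Qed.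

Lemma splice_left m p q y : y <= m -> splice m p q y = p.[y].
Proof. by rewrite /splice => ->. Qed.

Lemma splice_right m p q y : m < y -> splice m p q y = q.[y].
Proof. by rewrite /splice leNgt => ->. Qed.

Lemma splice_right_le m p q y : p.[m] = q.[m] -> m <= y -> splice m p q y = q.[y].
Proof.
move=> pq; rewrite le_eqVlt => /predU1P[<-|]; last exact: splice_right.
by rewrite splice_left.
Qed.

(** The splice is p (min y m) + q (max y m) - p m. *)
Lemma splice_continuous m p q : p.[m] = q.[m] -> continuous (splice m p q).
Proof.
move=> pq.
have -> : splice m p q =
    (fun y => p.[Num.min y m] + q.[Num.max y m] - p.[m]).
  apply/funext => y; case: (leP y m) => ym.
    by rewrite splice_left// -pq addrK.
  by rewrite splice_right// addrAC subrr add0r.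
move=> x; apply: (@continuousB _ _ _
  (fun y => p.[Num.min y m] + q.[Num.max y m]) (cst p.[m])); last exact: cvg_cst.
apply: (@continuousD _ _ _ (fun y => p.[Num.min y m]) (fun y => q.[Num.max y m])).
  apply: (@continuous_comp _ _ _ (fun y => Num.min y m) (horner p)).
    by apply: (@continuous_min R R id (cst m)); [exact: cvg_id|exact: cvg_cst].
  exact: continuous_poly.
apply: (@continuous_comp _ _ _ (fun y => Num.max y m) (horner q)).
  by apply: (@continuous_max R R id (cst m)); [exact: cvg_id|exact: cvg_cst].
exact: continuous_poly.
Qed.

Lemma L2_poly c d p : L2 `]c, d[ (horner p).
Proof. exact: L2_continuous (@continuous_poly _ p). Qed.

Lemma L2_splice c d m p q : L2 `]c, d[ (splice m p q).
Proof.
case: (leP m c) => [mc|cm].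
  apply: eq_L2 (L2_poly c d q) => x; rewrite inE /= in_itv /= => /andP[cx _].
  by rewrite splice_right// (le_lt_trans mc).
case: (leP d m) => [dm|md].
  apply: eq_L2 (L2_poly c d p) => x; rewrite inE /= in_itv /= => /andP[_ xd].
  by rewrite splice_left// (le_trans (ltW xd)).
apply: (L2_split (ltW cm) (ltW md)).
  apply: eq_L2 (L2_poly c m p) => x; rewrite inE /= in_itv /= => /andP[_ xd].
  by rewrite splice_left// ltW.
apply: eq_L2 (L2_poly m d q) => x; rewrite inE /= in_itv /= => /andP[cx _].
by rewrite splice_right.
Qed.

Lemma inner_poly_C1 c d p phi dphi : c <= d -> C1_with phi dphi ->
  inner `]c, d[ (horner p) dphi =
  p.[d] * phi d - p.[c] * phi c - inner `]c, d[ (horner p^`()) phi.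
Proof.
move=> cd Cphi; have := Rintegral_C1 cd (C1_mul (C1_poly p) Cphi) => <-.
have L1 := @L2_poly c d; have Ldphi : L2 `]c, d[ dphi.
  by apply: L2_continuous; exact: Cphi.2.
have Lphi : L2 `]c, d[ phi by apply: L2_continuous; exact: continuous_C1 Cphi.
by rewrite RintegralD ?addrK//; exact: L2_mul_integrable.
Qed.

(** Integration by parts on each piece; the two boundary terms at m combine
    into the jump of the splice. The test function has no boundary condition:
    the constant 1 turns this into the fundamental theorem of calculus. *)
Lemma inner_splice_C1 c m d p q phi dphi : c <= m -> m <= d -> C1_with phi dphi ->
  inner `]c, d[ (splice m p q) dphi =
  q.[d] * phi d - p.[c] * phi c + (p.[m] - q.[m]) * phi m -
  inner `]c, d[ (splice m p^`() q^`()) phi.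
Proof.
move=> cm md Cphi; have Ldphi : L2 `]c, d[ dphi.
  by apply: L2_continuous; exact: Cphi.2.
have Lphi : L2 `]c, d[ phi by apply: L2_continuous; exact: continuous_C1 Cphi.
have left p1 q1 f : inner `]c, m[ (splice m p1 q1) f = inner `]c, m[ (horner p1) f.
  apply: eq_inner => // x; rewrite inE /= in_itv /= => /andP[_ xd].
  by rewrite splice_left// ltW.
have right p1 q1 f : inner `]m, d[ (splice m p1 q1) f = inner `]m, d[ (horner q1) f.
  apply: eq_inner => // x; rewrite inE /= in_itv /= => /andP[cx _].
  by rewrite splice_right.
rewrite !(inner_split cm md) ?left ?right//; try exact: L2_splice.
rewrite (inner_poly_C1 _ cm Cphi) (inner_poly_C1 _ md Cphi).
by ring.
Qed.

Lemma Rintegral_splice c m d p q : c <= m -> m <= d -> p.[m] = q.[m] ->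
  \int[mu]_(x in `]c, d[) splice m p^`() q^`() x = q.[d] - p.[c].
Proof.
move=> cm md pq.
have C1 : C1_with (cst 1 : R -> R) (cst 0).
  by split=> x; [exact: is_derive_cst|exact: cvg_cst].
have := inner_splice_C1 p q cm md C1; rewrite pq subrr mul0r addr0 !mulr1.
have -> : inner `]c, d[ (splice m p q) (cst 0) = 0.
  rewrite /inner; under eq_Rintegral do rewrite mulr0.
  by rewrite Rintegral_cst// mul0r.
move=> /eqP; rewrite eq_sym subr_eq0 => /eqP ->.
by apply: eq_Rintegral => x _; rewrite /= mulr1.
Qed.

End Splice.

(** * Weak derivatives *)

Section WeakDerivative.
Context {R : realType}.
Implicit Types (c d m : R) (f g h phi dphi : R -> R) (p q : {poly R}).
Local Notation mu := (@lebesgue_measure R).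

Lemma C1c_C1 D phi : C1c D phi -> C1_with phi phi^`()%classic.
Proof.
move=> [d c _]; split=> // x; apply: DeriveDef; first exact: d.
by rewrite derive1E.
Qed.

Lemma C1cI D phi dphi (K : set R) : C1_with phi dphi -> compact K -> K `<=` D ->
  (forall x, ~ K x -> phi x = 0) -> C1c D phi.
Proof.
move=> Cphi cK KD phi0; split.
- by move=> x; have [+ _] := Cphi; move=> /(_ x)/@ex_derive.
- by rewrite (derive1_C1 Cphi); exact: Cphi.2.
- by exists K; split.
Qed.

Lemma C1c_ends c d phi : C1c `]c, d[ phi -> phi c = 0 /\ phi d = 0.
Proof.
move=> [_ _ [K [_ KD phi0]]]; split; apply: phi0 => /KD /=;
  by rewrite in_itv /= ltxx ?andbF.
Qed.

(** The difference quotient of t |t| with step h is within |h| of 2 |t|. *)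
Lemma C1_mulr_norm : C1_with (fun t : R => t * `|t|) (fun t => 2 * `|t|).
Proof.
have key (t : R) : (fun h : R => h^-1 *: (((fun s : R => s * `|s|) \o shift t) (h *: (1 : R)) -
    t * `|t|)) @ (0 : R)^' --> 2 * `|t|.
  apply/cvgrPdist_le => e e0; near=> h.
  have h0 : h != 0 by near: h; exact: nbhs_dnbhs_neq.
  have he : `|h| <= e by near: h; apply: dnbhs0_le.
  apply: le_trans he; rewrite /= /GRing.scale /= mulr1.
  rewrite -(ler_pM2l (_ : 0 < `|h|)) ?normr_gt0// -normrM mulrBr mulVKf//.
  have hb : `|h * (2 * `|t|) - ((h + t) * `|h + t| - t * `|t|)| <= h ^+ 2.
    rewrite ler_norml; case: (ger0P t) => t0; case: (ger0P (h + t)) => ht0; nra.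
  by rewrite (le_trans hb)// -(real_normK (num_real h)).
split=> [t|].
  by apply: DeriveDef; [apply/cvg_ex; exists (2 * `|t|)|apply/cvg_lim => //]; exact: key.
by move=> t; apply: (@continuousM _ _ (cst 2) (fun t => `|t|));
  [exact: cvg_cst|exact: norm_continuous].
Unshelve. all: by end_near. Qed.

(** This is 2 (max w 0)^2 for w = (y - a) (b - y), written so that t |t| is its
    only nonpolynomial ingredient. *)
Definition bump (a b y : R) : R :=
  ((y - a) * (b - y)) ^+ 2 + (y - a) * (b - y) * `|(y - a) * (b - y)|.

Lemma bump_C1 (a b : R) : exists dbump, C1_with (bump a b) dbump.
Proof.
pose w : {poly R} := ('X - a%:P) * (b%:P - 'X).
have wE y : w.[y] = (y - a) * (b - y) by rewrite /w !hornerE.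
have [d1 c1] := C1_comp C1_mulr_norm (C1_poly w).
have [d2 c2] := C1_poly (w ^+ 2).
exists (fun y => (w ^+ 2)^`().[y] + 2 * `|w.[y]| * w^`().[y]); split.
  move=> x; rewrite (_ : bump a b = (horner (w ^+ 2)) + (fun y => w.[y] * `|w.[y]|)).
    exact: is_deriveD.
  by apply/funext => y; rewrite /bump fctE horner_exp wE.
by move=> x; apply: (@continuousD _ _ _ (horner (w ^+ 2)^`())
  (fun y => 2 * `|w.[y]| * w^`().[y])); [exact: c2|exact: c1].
Qed.

Lemma bump_out (a b y : R) : (y - a) * (b - y) <= 0 -> bump a b y = 0.
Proof. by move=> w0; rewrite /bump ler0_norm// mulrN expr2 subrr. Qed.

Lemma bump_in (a b y : R) : 0 < (y - a) * (b - y) -> 0 < bump a b y.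
Proof. by move=> w0; rewrite /bump gtr0_norm//; nra. Qed.

Lemma bump_ge0 (a b y : R) : 0 <= bump a b y.
Proof.
by case: (leP ((y - a) * (b - y)) 0) => [/bump_out->|/bump_in/ltW].
Qed.

(** C^1 functions with values in [0, 1], supported in [a, b], that increase
    with n to the indicator of ]a, b[. *)
Definition cutoff (a b : R) (n : nat) (y : R) : R := 1 - expR (- (n%:R * bump a b y)).

Lemma cutoff_C1c c d (a b : R) n : c < a -> a <= b -> b < d ->
  C1c `]c, d[ (cutoff a b n).
Proof.
move=> ca ab bd; have [db Cb] := bump_C1 a b.
have CE : C1_with (@expR R) (@expR R).
  by split=> x; [exact: is_derive_expR|exact: continuous_expR].
have := C1_comp (C1_poly (1 - 'X)) (C1_comp CE (C1_comp (C1_poly (- n%:R *: 'X)) Cb)).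
set phi := (X in C1_with X _) => Cphi.
have -> : cutoff a b n = phi.
  by apply/funext => y; rewrite /phi /cutoff !hornerE mulNr.
apply: (C1cI Cphi (@segment_compact _ a b)).
  by move=> x /=; rewrite !in_itv /=; lra.
move=> x /= /negP; rewrite in_itv /= negb_and -!ltNge => xab.
by rewrite /phi bump_out ?hornerE ?mulr0 ?expR0 ?subrr//; case/orP: xab => ?; nra.
Qed.

Lemma cutoff_itv01 (a b : R) n y : 0 <= cutoff a b n y <= 1.
Proof.
by rewrite subr_ge0 expR_le1 oppr_le0 mulr_ge0 ?bump_ge0//= gerBl expR_ge0.
Qed.

Lemma cvg_cutoff (a b y : R) : a <= b ->
  cutoff a b n y @[n --> \oo] --> (\1_(`]a, b[%classic) y : R).
Proof.
move=> ab; rewrite indicE; case: (boolP (y \in _)); rewrite ?inE ?notin_setE /= in_itv /=.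
  move=> /andP[ay yb]; have b0 : 0 < bump a b y by apply: bump_in; nra.
  rewrite -[X in _ --> X]subr0; apply: cvgB; first exact: cvg_cst.
  under eq_fun do rewrite -mulrN expRM_natl.
  by apply: cvg_expr; rewrite ger0_norm ?expR_ge0// expR_lt1 oppr_lt0.
move=> /negP; rewrite negb_and -!leNgt => h.
rewrite (_ : (fun n => _) = cst 0); first exact: cvg_cst.
apply/funext => n; rewrite /cutoff bump_out ?mulr0 ?oppr0 ?expR0 ?subrr//.
by case/orP: h => ?; nra.
Qed.

Lemma L2_C1c c d D phi : C1c D phi -> L2 `]c, d[ phi.
Proof. by move=> /C1c_C1 C; apply: L2_continuous; exact: continuous_C1 C. Qed.

Lemma L2_integrable c d h : L2 `]c, d[ h -> mu.-integrable `]c, d[ (EFin \o h).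
Proof.
move=> lh; have l1 : L2 `]c, d[ (cst 1 : R -> R).
  by apply: L2_continuous => x; exact: cvg_cst.
have := L2_mul_integrable (measurable_itv _) lh l1.
by apply: eq_integrable => // x _ /=; rewrite mulr1.
Qed.

(** Dominated convergence along the cutoffs of ]a, b[. *)
Lemma Rintegral_orthogonal c d h (a b : R) : L2 `]c, d[ h ->
  (forall phi, C1c `]c, d[ phi -> inner `]c, d[ h phi = 0) ->
  c < a -> a <= b -> b < d -> \int[mu]_(x in `]a, b[) h x = 0.
Proof.
move=> lh orth ca ab bd; pose D : set R := `]c, d[%classic.
have ih := L2_integrable lh.
have mh : measurable_fun D h by apply: L2_measurable => //; exact: measurable_itv.
have mcut n : measurable_fun D (cutoff a b n).
  have := L2_C1c c d (cutoff_C1c n ca ab bd).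
  by apply: L2_measurable; exact: measurable_itv.
have sub : `]a, b[ `<=` D by move=> x; rewrite /D /= !in_itv /=; lra.
have [] := @dominated_convergence _ _ _ mu D (measurable_itv _)
  (fun n x => (h x * cutoff a b n x)%:E)
  (fun x => (h x * \1_(`]a, b[%classic) x)%:E) (fun x => `|h x|%:E).
- by move=> n; apply/measurable_EFinP; apply: measurable_funM; [exact: mh|exact: mcut].
- apply/measurable_EFinP; apply: measurable_funM; first exact: mh.
  apply: measurable_funTS; exact: measurable_indic.
- apply: aeW => x Dx; apply/fine_cvgP; split; first exact: nearW.
  by apply: cvgM; [exact: cvg_cst|exact: cvg_cutoff].
- exact: integrable_abse ih.
- apply: aeW => x n Dx; rewrite /= lee_fin normrM ler_piMr//.
  by have /andP[c0 c1] := cutoff_itv01 a b n x; rewrite ger0_norm.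
move=> _ _.
have -> : (fun n => \int[mu]_(x in D) (h x * cutoff a b n x)%:E)%E = cst 0%E.
  apply/funext => n /=; have := orth _ (cutoff_C1c n ca ab bd).
  rewrite /inner /Rintegral => /eqP.
  have iI := L2_mul_integrable (measurable_itv _) lh (L2_C1c c d (cutoff_C1c n ca ab bd)).
  by rewrite -eqe fineK => [/eqP|]; last exact: (@integrable_fin_num _ _ _ mu).
move=> /(cvg_lim (@ereal_hausdorff R)); rewrite lim_cst; last exact: ereal_hausdorff.
move=> I0; rewrite /Rintegral.
suff -> : (\int[mu]_(x in `]a, b[) (h x)%:E)%E =
  (\int[mu]_(x in D) (h x * \1_(`]a, b[%classic) x)%:E)%E by rewrite -I0.
rewrite -[in LHS](setIidr sub) integral_mkcondr; apply: eq_integral => x _.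
rewrite patchE indicE; case: ifP => _; by rewrite ?mulr1 ?mulr0.
Qed.

(** The fundamental lemma of the calculus of variations. The integral of h over
    every compact subinterval vanishes, hence its primitive is locally constant;
    but the derivative of the primitive is h almost everywhere, by Lebesgue
    differentiation. *)
Lemma orthogonal_C1c_eq0 c d h : L2 `]c, d[ h ->
  (forall phi, C1c `]c, d[ phi -> inner `]c, d[ h phi = 0) ->
  h = cst 0 %[ae mu in `]c, d[%classic].
Proof.
move=> lh orth; pose D : set R := `]c, d[%classic.
have mD : measurable D by exact: measurable_itv.
have ih := L2_integrable lh.
have ihD : mu.-integrable setT (EFin \o (h \_ D)).
  have := (@integrable_mkcond _ _ _ mu D (EFin \o h) mD).1 ih.
  by rewrite restrict_EFin.
have ihy y : mu.-integrable `]-oo, y] (EFin \o (h \_ D)).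
  by apply: integrableS ihD => //; exact: measurable_itv.
pose F x := \int[mu]_(t in `]-oo, x]) (h \_ D) t.
have FTC : \forall x \ae mu, derivable F x 1 /\ F^`()%classic x = (h \_ D) x.
  exact: FTC1Ny ihy (integrable_locally mD ih).
apply: ae_imply FTC => x [_ Fx] Dx /=.
have -> : h x = F^`()%classic x by rewrite Fx patchE mem_set.
rewrite derive1E.
rewrite (@near_eq_derive _ _ _ _ (cst (F x))); first by rewrite derive_cst.
have : \forall y \near x, y \in `]c, d[ by exact: near_in_itvoo.
apply: filterS => y Dy.
have FB (s t : R) : D s -> D t -> s <= t -> F t = F s.
  move=> Ds Dt st; apply/eqP; rewrite -subr_eq0; apply/eqP.
  have := @Rintegral_itvB R (h \_ D) -oo%O (BRight t) s (ihy t) isT st.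
  rewrite -/(F t) -/(F s) => ->.
  have mst : measurable `]s, t[%classic by exact: measurable_itv.
  rewrite -Rintegral_itv_bndo_bndc; last first.
    by apply: integrableS ihD => //; exact: measurable_itv.
  rewrite (_ : \int[mu]_(z in `]s, t[) (h \_ D) z = \int[mu]_(z in `]s, t[) h z); last first.
    apply: eq_Rintegral => z; rewrite inE /= in_itv /= => /andP[sz zt].
    rewrite patchE mem_set// /D /= in_itv /=.
    by move: Ds Dt; rewrite /D /= !in_itv /=; lra.
  apply: (Rintegral_orthogonal lh orth) => //.
  - by move: Ds; rewrite /D /= in_itv /= => /andP[].
  - by move: Dt; rewrite /D /= in_itv /= => /andP[].
case: (leP x y) => xy; first by rewrite (FB x y).
by rewrite (FB y x)// ltW.
Qed.

Lemma weak_derivative_unique c d v g1 g2 : L2 `]c, d[ g1 -> L2 `]c, d[ g2 ->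
  weak_derivative `]c, d[ v g1 -> weak_derivative `]c, d[ v g2 ->
  g1 = g2 %[ae mu in `]c, d[%classic].
Proof.
move=> l1 l2 w1 w2; have mD := measurable_itv (Interval (BRight c) (BLeft d)).
have := @orthogonal_C1c_eq0 c d (fun x => g1 x - g2 x) (L2B mD l1 l2).
have orth phi : C1c `]c, d[ phi -> inner `]c, d[ (fun x => g1 x - g2 x) phi = 0.
  move=> Cphi; have lphi := L2_C1c c d Cphi; rewrite innerBl//.
  by have := w1 _ Cphi; rewrite (w2 _ Cphi); lra.
move=> /(_ orth); apply: ae_imply => x h /h /= /eqP; rewrite subr_eq0 => /eqP.
by [].
Qed.

Lemma weak_derivative_ae c d v v' g : L2 `]c, d[ v -> L2 `]c, d[ v' ->
  v = v' %[ae mu in `]c, d[%classic] -> weak_derivative `]c, d[ v' g ->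
  weak_derivative `]c, d[ v g.
Proof.
move=> lv lv' vv' w phi Cphi; rewrite -w//.
have ld : L2 `]c, d[ phi^`()%classic.
  by apply: L2_continuous; have [] := C1c_C1 Cphi.
by apply: inner_ae => //; exact: aeW.
Qed.

Lemma weak_derivative_splice c m d p q : c <= m -> m <= d -> p.[m] = q.[m] ->
  weak_derivative `]c, d[ (splice m p q) (splice m p^`() q^`()).
Proof.
move=> cm md pq phi Cphi; rewrite (inner_splice_C1 _ _ cm md (C1c_C1 Cphi)).
by have [-> ->] := C1c_ends Cphi; rewrite pq !mulr0 !subrr mul0r addr0 sub0r.
Qed.

Lemma grad_weak c d v g : L2 `]c, d[ g -> weak_derivative `]c, d[ v g ->
  L2 `]c, d[ (grad `]c, d[ v) /\ grad `]c, d[ v = g %[ae mu in `]c, d[%classic].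
Proof.
move=> lg wg.
have [l1 w1] : L2 `]c, d[ (grad `]c, d[ v) /\ weak_derivative `]c, d[ v (grad `]c, d[ v).
  by apply: (@xgetPex _ (cst 0) [set g | L2 `]c, d[ g /\ weak_derivative `]c, d[ v g]); exists g.
by split=> //; exact: weak_derivative_unique wg.
Qed.

(** Through this lemma grad, which is only a chosen weak derivative, becomes the
    elementwise derivative of a continuous piecewise polynomial. *)
Lemma H1_ae_splice c m d v p q : c <= m -> m <= d -> p.[m] = q.[m] ->
  measurable_fun `]c, d[ v -> v = splice m p q %[ae mu in `]c, d[%classic] ->
  [/\ H1 `]c, d[ v, L2 `]c, d[ (grad `]c, d[ v) &
      grad `]c, d[ v = splice m p^`() q^`() %[ae mu in `]c, d[%classic] ].
Proof.
move=> cm md pq mv vpq.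
have lv : L2 `]c, d[ v by apply: (L2_ae _ mv vpq) => //; exact: L2_splice.
have w : weak_derivative `]c, d[ v (splice m p^`() q^`()).
  apply: (weak_derivative_ae lv (L2_splice c d m p q) vpq).
  exact: weak_derivative_splice.
have [lg gE] := grad_weak (L2_splice c d m _ _) w.
split=> //; split=> //; exists (splice m p^`() q^`()); split=> //; exact: L2_splice.
Qed.

Lemma ae_neq (m : R) : \forall x \ae mu, x != m.
Proof.
exists [set m]; split => //; first exact: lebesgue_measure_set1.
by move=> x /= /negP; rewrite negbK => /eqP.
Qed.

(** Let h be the elementwise derivative minus the weak derivative. Integrating
    by parts, h tests as the jump J at m times a Dirac mass. Hence (y - m) h is
    orthogonal to all test functions, so h = 0 almost everywhere, and testing h
    with a function that is nonzero at m gives J = 0. *)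
Lemma H1_no_jump c m d v p q : c < m -> m < d ->
  H1 `]c, d[ v -> v = splice m p q %[ae mu in `]c, d[%classic] -> p.[m] = q.[m].
Proof.
move=> cm md [lv [g [lg wg]]] vpq.
have mD := measurable_itv (Interval (BRight c) (BLeft d)).
pose h x := splice m p^`() q^`() x - g x.
have lh : L2 `]c, d[ h by apply: L2B => //; exact: L2_splice.
have hE phi : C1c `]c, d[ phi -> inner `]c, d[ h phi = (p.[m] - q.[m]) * phi m.
  move=> Cphi; have C := C1c_C1 Cphi; have lphi := L2_C1c c d Cphi.
  have := inner_splice_C1 p q (ltW cm) (ltW md) C.
  have [-> ->] := C1c_ends Cphi; rewrite !mulr0 subrr add0r.
  have ld : L2 `]c, d[ phi^`()%classic by apply: L2_continuous; exact: C.2.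
  have -> : inner `]c, d[ (splice m p q) phi^`()%classic = inner `]c, d[ v phi^`()%classic.
    by apply: inner_ae => //; [exact: L2_splice|apply: ae_imply vpq => x e /e|exact: aeW].
  rewrite wg// innerBl//; last exact: L2_splice.
  by lra.
have CX : C1_with (fun x : R => x - m) (cst 1).
  have [] := C1_poly ('X - m%:P).
  rewrite derivB derivX derivC subr0.
  have -> : horner (1 : {poly R}) = cst 1 by apply/funext => x; rewrite hornerC.
  by have -> : horner ('X - m%:P) = (fun x => x - m) by apply/funext => x; rewrite !hornerE.
have lX : L2 `]c, d[ (fun x => (x - m) * h x).
  have b x : `]c, d[%classic x -> `|(x - m) * h x| <= `|(d - c) * h x|.
    rewrite /= in_itv /= => /andP[cx xd]; rewrite !normrM ler_wpM2r//.
    by rewrite ler_norml (ger0_norm (_ : 0 <= d - c)) ?subr_ge0; lra.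
  apply: L2_le (b) _ => //; last exact: L2Z.
  apply: measurable_funM; last exact: L2_measurable.
  by apply: measurable_funTS; apply: continuous_measurable_fun; exact: continuous_C1 CX.
have /orthogonal_C1c_eq0 : L2 `]c, d[ (fun x => (x - m) * h x) := lX.
have orth phi : C1c `]c, d[ phi -> inner `]c, d[ (fun x => (x - m) * h x) phi = 0.
  move=> Cphi; have CXphi : C1c `]c, d[ (fun x => (x - m) * phi x).
    have [_ _ [K [cK KD phi0]]] := Cphi.
    apply: (C1cI (C1_mul CX (C1c_C1 Cphi)) cK KD) => x /phi0 ->.
    by rewrite mulr0.
  have := hE _ CXphi; rewrite subrr mul0r mulr0 => <-.
  by apply: eq_Rintegral => x _; rewrite mulrCA mulrA.
move=> /(_ orth) Xh0.
have h0 : h = cst 0 %[ae mu in `]c, d[%classic].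
  apply: ae_imply2 Xh0 (ae_neq m) => x e xm /e /= /eqP.
  by rewrite mulf_eq0 subr_eq0 (negbTE xm) => /eqP.
have Cb : C1c `]c, d[ (cutoff ((c + m) / 2) ((m + d) / 2) 1).
  by apply: cutoff_C1c; lra.
have := hE _ Cb.
have -> : inner `]c, d[ h (cutoff ((c + m) / 2) ((m + d) / 2) 1) = 0.
  have l0 : L2 `]c, d[ (cst 0 : R -> R) by apply: L2_continuous => x; exact: cvg_cst.
  have lb := L2_C1c c d Cb.
  rewrite (inner_ae mD lh l0 lb lb h0); last exact: aeW.
  rewrite /inner; under eq_Rintegral do rewrite mul0r.
  by rewrite Rintegral_cst// mul0r.
move=> /esym/eqP; rewrite mulf_eq0 subr_eq0 => /orP[/eqP//|].
rewrite gt_eqF// subr_gt0 expR_lt1 oppr_lt0 mul1r; apply: bump_in.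
by rewrite mulr_gt0//; lra.
Qed.

End WeakDerivative.


(** * The error on one vertex patch *)

Section Patch.
Context {R : realType}.
Implicit Types (c d m l r b : R) (f g u v psi phi : R -> R) (p q : {poly R}).
Local Notation mu := (@lebesgue_measure R).

Lemma poly_primitive p m : exists P : {poly R}, P^`() = p /\ P.[m] = 0.
Proof.
pose P0 : {poly R} := \poly_(i < (size p).+1) (p`_i.-1 / i%:R).
exists (P0 - P0.[m]%:P); split; last by rewrite !hornerE subrr.
rewrite derivB derivC subr0; apply/polyP => i; rewrite coef_deriv coef_poly ltnS.
case: ltnP => ip /=; last by rewrite mul0rn nth_default.
by rewrite -[_ *+ _]mulr_natr divfK// pnatr_eq0.
Qed.

Lemma size_deriv_le p : (size p^`() <= (size p).-1)%N.
Proof. exact: size_poly. Qed.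

Lemma deriv_affine p : (size p <= 2)%N -> exists a, p^`() = a%:P.
Proof.
move=> sp; exists p^`()`_0; apply: size1_polyC.
by rewrite (leq_trans (size_deriv_le p))//; case: (size p) sp => [|[|[]]].
Qed.

(** The a priori bound M makes the essential supremum finite, without which
    normoo would be the default value 0. *)
Lemma normoo_ae (D : set R) g (M : R) : measurable D ->
  (\forall x \ae mu, D x -> `|g x| <= M) ->
  \forall x \ae mu, D x -> `|g x| <= normoo D g.
Proof.
move=> mD gM.
have mupos : (0 < mu [set: R])%E.
  apply: (@lt_le_trans _ _ (mu `]0, 1[)); last first.
    by apply: le_measure; rewrite ?inE//; exact: measurable_itv.
  by rewrite lebesgue_measure_itv /= lte_fin ltr01 oppr0 adde0 lte_fin.
have M0 : \forall x \ae mu, `|(g \_ D) x| <= Num.max M 0.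
  apply: ae_imply gM => x gM; rewrite patchE; case: ifPn => [|_].
    by rewrite inE => /gM h; rewrite le_max h.
  by rewrite normr0 le_max lexx orbT.
rewrite /normoo unlock mupos.
set e := ess_sup _ _.
have e1 : (e <= (Num.max M 0)%:E)%E.
  apply/ess_supP; apply: ae_imply M0 => x h /=.
  by rewrite lee_fin.
have e2 : \forall x \ae mu, (`|((g \_ D) x)%:E| <= e)%E := ess_sup_ge _ _.
have e0 : (0 <= e)%E by apply: ess_sup_gee => //; apply: aeW => x /=.
have ef : e \is a fin_num by rewrite ge0_fin_numE// (le_lt_trans e1)// ltry.
apply: ae_imply e2 => x + Dx; rewrite patchE mem_set// -(fineK ef).
by rewrite /= lee_fin.
Qed.

Lemma normoo_ge0 (D : set R) g : 0 <= normoo D g.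
Proof. by rewrite fine_ge0// Lnorm_ge0. Qed.

Lemma L2_zero (D : set R) : measurable D -> L2 D (cst 0 : R -> R).
Proof.
move=> mD; apply: L2I => //; under eq_fun do rewrite /= expr0n.
exact: integrable0.
Qed.

Lemma inner0l (D : set R) f g : {in D, f =1 cst 0} -> inner D f g = 0.
Proof.
move=> f0; rewrite /inner (@eq_Rintegral _ _ _ mu D (cst 0)).
  by rewrite /Rintegral integral0.
by move=> x xD; rewrite f0// mul0r.
Qed.

Lemma inner_extend l c d r f g : l <= c -> c <= d -> d <= r ->
  L2 `]l, r[ f -> L2 `]l, r[ g ->
  {in `]l, c[%classic, f =1 cst 0} -> {in `]d, r[%classic, f =1 cst 0} ->
  inner `]l, r[ f g = inner `]c, d[ f g.
Proof.
move=> lc cd dr lf lg f1 f2; have cr := le_trans cd dr.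
rewrite (inner_split lc cr lf lg) inner0l// add0r.
have sub : `]c, r[ `<=` (`]l, r[ : set R) by move=> x /=; rewrite !in_itv /=; lra.
rewrite (inner_split cd dr); [|exact: L2S lf|exact: L2S lg].
by rewrite [X in _ + X]inner0l// addr0.
Qed.

Lemma L2_extend l c d r f : l <= c -> c <= d -> d <= r ->
  L2 `]c, d[ f ->
  {in `]l, c[%classic, f =1 cst 0} -> {in `]d, r[%classic, f =1 cst 0} ->
  L2 `]l, r[ f.
Proof.
move=> lc cd dr lf f1 f2.
have z1 : L2 `]l, c[ f by apply: eq_L2 (L2_zero (measurable_itv _)) => x /f1 ->.
have z2 : L2 `]d, r[ f by apply: eq_L2 (L2_zero (measurable_itv _)) => x /f2 ->.
exact: L2_split (le_trans cd dr) z1 (L2_split cd dr lf z2).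
Qed.

(** Composing with the clamp extends a continuous function on [c, d] to a
    continuous function on the line, constant on either side. *)
Definition clamp c d y : R := Num.max c (Num.min y d).

Lemma clamp_continuous c d : continuous (clamp c d).
Proof.
move=> x; apply: (@continuous_max R R (cst c) (fun y => Num.min y d)).
  exact: cvg_cst.
by apply: (@continuous_min R R id (cst d)); [exact: cvg_id|exact: cvg_cst].
Qed.

(** The weak equation for u, tested with the function z that is the splice on
    [c, d] and 0 on the rest of ]l, r[. Extension by zero preserves continuity
    at an end of the patch where the splice vanishes; the only other possibility
    is an end of the patch that is the vertex itself and an end of ]l, r[, where
    nothing has to be extended and only the outflow condition matters. *)
Lemma test_function l c m d r b f u (z1 z2 : {poly R}) :
  l <= c -> c <= m -> m <= d -> d <= r -> l < r -> z1.[m] = z2.[m] ->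
  z1.[c] = 0 \/ (c = m /\ c = l) -> z2.[d] = 0 \/ (d = m /\ d = r) ->
  (outflow b l r m -> z1.[m] = 0) ->
  L2 `]l, r[ f -> L2 `]l, r[ u ->
  (forall v, H1_outflow b l r v ->
     - inner `]l, r[ u (fun y => b * grad `]l, r[ v y) = inner `]l, r[ f v) ->
  - inner `]c, d[ u (fun y => b * splice m z1^`() z2^`() y) =
  inner `]c, d[ f (splice m z1 z2).
Proof.
move=> lc cm md dr lr z12 z1c z2d zO lf lu sol.
have cd := le_trans cm md.
have mD := @measurable_itv R `]c, d[; have mO := @measurable_itv R `]l, r[.
pose z y := splice m z1 z2 (clamp c d y).
pose G := (splice m z1^`() z2^`()) \_ `]c, d[.
have zl y : y <= c -> z y = z1.[c].
  by move=> yc; rewrite /z /clamp min_l ?(le_trans yc)// max_l// splice_left.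
have zr y : d <= y -> z y = z2.[d].
  by move=> yc; rewrite /z /clamp min_r// max_r// splice_right_le.
have zin : {in `]c, d[%classic, z =1 splice m z1 z2}.
  move=> y; rewrite inE /= in_itv /= => /andP[cy yd].
  by rewrite /z /clamp min_l ?max_r// ltW.
have z0l : {in `]l, c[%classic, z =1 cst 0}.
  move=> y; rewrite inE /= in_itv /= => /andP[ly yc]; rewrite zl ?(ltW yc)//.
  by case: z1c => // -[_ e]; move: (lt_trans ly yc); rewrite e ltxx.
have z0r : {in `]d, r[%classic, z =1 cst 0}.
  move=> y; rewrite inE /= in_itv /= => /andP[dy yr]; rewrite zr ?(ltW dy)//.
  by case: z2d => // -[_ e]; move: (lt_trans dy yr); rewrite e ltxx.
have Gin : {in `]c, d[%classic, G =1 splice m z1^`() z2^`()}.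
  by move=> y yD; rewrite /G patchE yD.
have G0l : {in `]l, c[%classic, G =1 cst 0}.
  move=> y; rewrite inE /= in_itv /= => /andP[ly yc].
  by rewrite /G patchE memNset//= in_itv /= ltNge (ltW yc).
have G0r : {in `]d, r[%classic, G =1 cst 0}.
  move=> y; rewrite inE /= in_itv /= => /andP[dy yr].
  by rewrite /G patchE memNset//= in_itv /= (ltNge y) (ltW dy) andbF.
have cz : continuous z.
  move=> y; apply: (@continuous_comp _ _ _ (clamp c d) (splice m z1 z2)).
    exact: clamp_continuous.
  exact: splice_continuous.
have lz : L2 `]l, r[ z by exact: L2_continuous.
have lG : L2 `]l, r[ G.
  apply: (L2_extend lc cd dr) => //.
  by apply: eq_L2 (L2_splice c d m z1^`() z2^`()) => y /Gin ->.
have wz : weak_derivative `]l, r[ z G.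
  move=> phi Cphi; have C := C1c_C1 Cphi; have lphi := L2_C1c l r Cphi.
  have ld : L2 `]l, r[ phi^`()%classic by apply: L2_continuous; exact: C.2.
  rewrite (inner_extend lc cd dr lz ld)// (inner_extend lc cd dr lG lphi)//.
  rewrite (eq_inner zin (g2 := phi^`()%classic))// (eq_inner Gin (g2 := phi))//.
  rewrite (inner_splice_C1 _ _ cm md C) z12 subrr mul0r addr0.
  have [phil phir] := C1c_ends Cphi.
  have -> : z1.[c] * phi c = 0.
    by case: z1c => [->|[_ ->]]; rewrite ?phil ?mul0r ?mulr0.
  have -> : z2.[d] * phi d = 0.
    by case: z2d => [->|[_ ->]]; rewrite ?phir ?mul0r ?mulr0.
  by rewrite subrr sub0r.
have [lgr grE] := grad_weak lG wz.
have Hz : H1_outflow b l r z.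
  split; first by split=> //; exists G.
  exists z; split=> //; first exact: continuous_subspaceT; first exact: aeW.
  move=> x [[->|->] nb].
    rewrite zl//; case: z1c => // -[ec el]; rewrite ec zO//; split; first by left; rewrite -ec.
    by rewrite -ec el.
  rewrite zr//; case: z2d => // -[ed er]; rewrite ed -z12 zO//; split; first by right; rewrite -ed.
  by rewrite -ed er.
have := sol _ Hz.
have lbG : L2 `]l, r[ (fun y => b * G y) by exact: L2Z.
have lbg : L2 `]l, r[ (fun y => b * grad `]l, r[ z y) by exact: L2Z.
have -> : inner `]l, r[ u (fun y => b * grad `]l, r[ z y) =
          inner `]l, r[ u (fun y => b * G y).
  apply: inner_ae => //; first exact: aeW.
  by apply: ae_imply grE => x e /e ->.
rewrite innerC (inner_extend lc cd dr lbG lu); last 2 first.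
- by move=> y /G0l ->; rewrite mulr0.
- by move=> y /G0r ->; rewrite mulr0.
rewrite [X in _ = X -> _]innerC (inner_extend lc cd dr lz lf)//.
rewrite ![inner _ u _]innerC (innerC _ f) (eq_inner zin (g2 := f))//.
move=> <-; congr (- _); apply: eq_inner => // y /Gin ->.
by [].
Qed.


Lemma L2_ae_splice c m d v (p q : {poly R}) :
  measurable_fun `]c, d[ v -> v = splice m p q %[ae mu in `]c, d[%classic] ->
  L2 `]c, d[ v.
Proof. by move=> mv e; apply: L2_ae e (L2_splice c d m p q). Qed.

(** The residual of the local problem is itself a piecewise polynomial of degree
    at most k, because psi is affine on each piece and psi f is a piecewise
    polynomial of degree at most k. Hence it is an admissible test function,
    orthogonal to itself. *)
Lemma strong_local_equation c m d b k f psi s uh (h1 h2 s1 s2 u1 u2 F1 F2 : {poly R}) :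
  let D : set R := `]c, d[%classic in
  c <= m -> m <= d -> h1.[m] = h2.[m] -> s1.[m] = s2.[m] ->
  (size h1 <= 2)%N -> (size h2 <= 2)%N ->
  (size s1 <= k.+1)%N -> (size s2 <= k.+1)%N ->
  (size u1 <= k.+1)%N -> (size u2 <= k.+1)%N ->
  (size F1 <= k.+1)%N -> (size F2 <= k.+1)%N ->
  {in D, psi =1 splice m h1 h2} ->
  measurable_fun D s -> s = splice m s1 s2 %[ae mu in D] ->
  measurable_fun D uh -> uh = splice m u1 u2 %[ae mu in D] ->
  measurable_fun D (fun y => psi y * f y) ->
  (fun y => psi y * f y) = splice m F1 F2 %[ae mu in D] ->
  (forall z1 z2 : {poly R}, (size z1 <= k.+1)%N -> (size z2 <= k.+1)%N ->
    inner D (fun y => b * grad D (fun z => psi z * s z) y) (splice m z1 z2) =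
    inner D (fun y => f y * psi y + b * grad D psi y * uh y) (splice m z1 z2)) ->
  splice m (b *: (h1 * s1)^`() - F1 - b *: (h1^`() * u1))
         (b *: (h2 * s2)^`() - F2 - b *: (h2^`() * u2)) = cst 0 %[ae mu in D].
Proof.
move=> D cm md h12 s12 sh1 sh2 ss1 ss2 su1 su2 sF1 sF2 psiE ms sE mu_ uE mF FE sol.
have mD : measurable D by exact: measurable_itv.
have Ls := @L2_splice R c d m.
have mpsi : measurable_fun D psi.
  by apply: L2_measurable => //; apply: eq_L2 (Ls h1 h2) => y /psiE ->.
have psi_ae : psi = splice m h1 h2 %[ae mu in D].
  by apply: aeW => y yD; rewrite psiE ?inE.
have [_ lgpsi gpsi] := H1_ae_splice cm md h12 mpsi psi_ae.
have ps_ae : (fun z => psi z * s z) = splice m (h1 * s1) (h2 * s2) %[ae mu in D].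
  by apply: ae_imply2 psi_ae sE => y e1 e2 Dy; rewrite e1// e2// spliceM.
have hs12 : (h1 * s1).[m] = (h2 * s2).[m] by rewrite !hornerM h12 s12.
have [_ lgps gps] := H1_ae_splice cm md hs12 (measurable_funM mpsi ms) ps_ae.
set e1 := _ - _ - _; set e2 := _ - _ - _.
have size_e (h s0 F u0 : {poly R}) : (size h <= 2)%N -> (size s0 <= k.+1)%N ->
    (size F <= k.+1)%N -> (size u0 <= k.+1)%N ->
    (size (b *: (h * s0)^`() - F - b *: (h^`() * u0))%R <= k.+1)%N.
  move=> sh ss sF su.
  have shs : (size (h * s0)%R <= k.+2)%N.
    rewrite (leq_trans (size_polyMleq _ _))//; lia.
  have shu : (size (h^`() * u0)%R <= k.+1)%N.
    rewrite (leq_trans (size_polyMleq _ _))//; have := size_deriv_le h; lia.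
  rewrite (leq_trans (size_polyD _ _))// geq_max size_polyN.
  rewrite (leq_trans (size_scale_leq _ _))// andbT.
  rewrite (leq_trans (size_polyD _ _))// geq_max size_polyN sF andbT.
  by rewrite (leq_trans (size_scale_leq _ _))//; have := size_deriv_le (h * s0); lia.
apply: inner_eq0_ae => //.
have := sol e1 e2 (size_e _ _ _ _ sh1 ss1 sF1 su1) (size_e _ _ _ _ sh2 ss2 sF2 su2).
have LG : L2 D (fun y => b * grad D (fun z => psi z * s z) y) by exact: L2Z.
rewrite (inner_ae mD LG (L2Z b mD (Ls (h1 * s1)^`() (h2 * s2)^`())) (Ls e1 e2) (Ls e1 e2)); last 2 first.
- by apply: ae_imply gps => y e /e ->.
- exact: aeW.
have rhs_ae : (fun y => f y * psi y + b * grad D psi y * uh y) =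
  splice m (F1 + b *: (h1^`() * u1)) (F2 + b *: (h2^`() * u2)) %[ae mu in D].
  have both : \forall y \ae mu, D y -> grad D psi y = splice m h1^`() h2^`() y /\
      uh y = splice m u1 u2 y.
    by apply: ae_imply2 gpsi uE => y e1' e2' Dy; rewrite e1'// e2'.
  apply: ae_imply2 FE both => y eF eq Dy; have [eg eu] := eq Dy.
  by rewrite mulrC eF// eg eu -mulrA spliceM spliceZ spliceD.
have mrhs : measurable_fun D (fun y => f y * psi y + b * grad D psi y * uh y).
  apply: measurable_funD.
    by apply: eq_measurable_fun mF => y _; rewrite mulrC.
  apply: measurable_funM => //; apply: measurable_funM => //; exact: L2_measurable.
have Lrhs := L2_ae_splice mrhs rhs_ae.
rewrite (inner_ae mD Lrhs (Ls _ _) (Ls e1 e2) (Ls e1 e2) rhs_ae); last exact: aeW.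
move=> /eqP; rewrite -subr_eq0 -innerBl//; last exact: L2Z.
move=> /eqP <-; apply: eq_inner => // y _.
by rewrite spliceZ spliceB /e1 /e2 !opprD !addrA.
Qed.

(** With psi = h, w = h (u_h - s) = b v' and E the (vanishing) residual of the
    local equation,
      w w = u_h b (h v)' + F v + E v - b (h s v)'
    holds identically. The last term integrates to the boundary values of h s v,
    and the second one is turned into - u b (h v)' by the equation for u. *)
Lemma energy_identity c m d b u (h1 h2 s1 s2 u1 u2 F1 F2 v1 v2 w1 w2 : {poly R}) :
  let D : set R := `]c, d[%classic in
  c <= m -> m <= d -> h1.[m] = h2.[m] -> s1.[m] = s2.[m] -> v1.[m] = v2.[m] ->
  b *: v1^`() = w1 -> b *: v2^`() = w2 ->
  w1 = h1 * (u1 - s1) -> w2 = h2 * (u2 - s2) ->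
  L2 D u ->
  splice m (b *: (h1 * s1)^`() - F1 - b *: (h1^`() * u1))
         (b *: (h2 * s2)^`() - F2 - b *: (h2^`() * u2)) = cst 0 %[ae mu in D] ->
  (h1 * s1 * v1).[c] = 0 -> (h2 * s2 * v2).[d] = 0 ->
  - inner D u (fun y => b * splice m (h1 * v1)^`() (h2 * v2)^`() y) =
    inner D (splice m F1 F2) (splice m v1 v2) ->
  inner D (splice m w1 w2) (splice m w1 w2) =
  inner D (fun y => splice m u1 u2 y - u y)
    (fun y => b * splice m (h1 * v1)^`() (h2 * v2)^`() y).
Proof.
move=> D cm md h12 s12 v12 vw1 vw2 w1E w2E lu E0 bc bd usol.
have mD : measurable D by exact: measurable_itv.
have Ls := @L2_splice R c d m.
rewrite innerBl//; last exact: L2Z; rewrite usol.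
set e1 := (X in splice m X _) in E0; set e2 := (X in splice m _ X) in E0.
have Ev : inner D (splice m e1 e2) (splice m v1 v2) = 0.
  rewrite (inner_ae mD (Ls _ _) (L2_zero mD) (Ls v1 v2) (Ls v1 v2) E0); last exact: aeW.
  by rewrite inner0l.
have Y0 : \int[mu]_(x in D) splice m (h1 * s1 * v1)^`() (h2 * s2 * v2)^`() x = 0.
  rewrite Rintegral_splice// ?bc ?bd ?subrr//.
  by rewrite !hornerM h12 s12 v12.
transitivity (inner D (splice m u1 u2) (fun y => b * splice m (h1 * v1)^`() (h2 * v2)^`() y)
  + inner D (splice m F1 F2) (splice m v1 v2) + inner D (splice m e1 e2) (splice m v1 v2)
  - b * \int[mu]_(x in D) splice m (h1 * s1 * v1)^`() (h2 * s2 * v2)^`() x).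
  rewrite /inner -RintegralZl//; last exact: L2_integrable (Ls _ _).
  rewrite -!RintegralD//; last 4 first.
  - apply: L2_integrable.
    have := Ls (u1 * (b *: (h1 * v1)^`()) + F1 * v1) (u2 * (b *: (h2 * v2)^`()) + F2 * v2).
    by apply: eq_L2 => y _; rewrite spliceZ !spliceM spliceD.
  - exact: L2_mul_integrable (Ls _ _) (Ls _ _).
  - exact: L2_mul_integrable (Ls _ _) (L2Z _ mD (Ls _ _)).
  - exact: L2_mul_integrable (Ls _ _) (Ls _ _).
  rewrite -RintegralB//; last 2 first.
  - apply: L2_integrable.
    have := Ls (u1 * (b *: (h1 * v1)^`()) + F1 * v1 + e1 * v1) (u2 * (b *: (h2 * v2)^`()) + F2 * v2 + e2 * v2).
    by apply: eq_L2 => y _; rewrite spliceZ !spliceM !spliceD.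
  - exact: L2_integrable (L2Z _ mD (Ls _ _)).
  apply: eq_Rintegral => y _; rewrite !(spliceZ m b) !spliceM !spliceD spliceB.
  have key (h s v U F w : {poly R}) : b *: v^`() = w -> w = h * (U - s) ->
    w * w = U * (b *: (h * v)^`()) + F * v +
      (b *: (h * s)^`() - F - b *: (h^`() * U)) * v - b *: (h * s * v)^`().
    move=> vw wE; rewrite {1}wE -vw !derivM -!mul_polyC; ring.
  by rewrite (key h1 s1 v1 u1 F1 w1)// (key h2 s2 v2 u2 F2 w2).
by rewrite Ev Y0 mulr0 subr0 addr0.
Qed.


Lemma inner_cst1 c d : c <= d -> inner `]c, d[ (cst 1) (cst 1 : R -> R) = d - c.
Proof.
move=> cd; have := Rintegral_C1 cd (C1_poly 'X); rewrite derivX !hornerX => <-.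
by apply: eq_Rintegral => x _; rewrite hornerC mulr1.
Qed.

Lemma L2_cst c d (k : R) : L2 `]c, d[ (cst k).
Proof. by apply: L2_continuous => x; exact: cvg_cst. Qed.

(** The test function v is normalised by its value at the vertex on the outflow
    boundary, and by its mean value elsewhere, as required by the two forms of
    the Poincare-Friedrichs inequality. *)
Lemma normalizing_constant (O : Prop) c m d (V1 V2 : {poly R}) : c < d ->
  exists k, (O -> k = 0) /\
   (~ O -> inner `]c, d[ (splice m (V1 - k%:P) (V2 - k%:P)) (cst 1) = 0).
Proof.
move=> cd; have [isO|nO] := pselect O; first by exists 0; split.
have mD := @measurable_itv R `]c, d[.
exists (inner `]c, d[ (splice m V1 V2) (cst 1) / (d - c)); split=> // _.
set k := _ / _.
have -> : inner `]c, d[ (splice m (V1 - k%:P) (V2 - k%:P)) (cst 1) =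
  inner `]c, d[ (fun y => splice m V1 V2 y - k * cst 1 y) (cst 1).
  apply: eq_inner => // y _; rewrite mulr1 -spliceB.
  by congr (_ - _); rewrite /splice !hornerC if_same.
have L1 := L2_cst c d 1; have LV := L2_splice c d m V1 V2.
rewrite innerBl//; last exact: L2Z.
rewrite innerZl// inner_cst1 ?ltW// /k divfK ?subrr//.
by rewrite subr_eq0 gt_eqF.
Qed.

(** If the vertex m is an outflow end of ]l, r[, then it is an end of its patch,
    and the only outflow end of it. *)
Lemma outflow_ends l c m d r b : l <= c -> c <= m -> m <= d -> d <= r -> c < d ->
  outflow b l r m -> forall x, outflow b c d x -> x = m.
Proof.
move=> lc cm md dr cd [mlr nm] x [xcd nx].
have lr : l < r by lra.
case: (ltgtP b 0) nm nx => [b0|b0|->]; last by rewrite mul0r ltxx.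
  rewrite !nmulr_rgt0// /normal; case: eqP => [ml _|_]; last by rewrite ltr10.
  case: eqP => [->|_]; last by rewrite ltr10.
  by move=> _; apply/eqP; rewrite eq_le cm /= ml lc.
rewrite !pmulr_rgt0// /normal; case: eqP => [_|ml _]; first by rewrite ltr0N1.
case: eqP => [_|xc _]; first by rewrite ltr0N1.
case: mlr => // mr; case: xcd => // ->.
by apply/eqP; rewrite eq_le md /= mr dr.
Qed.

(** Let v be the primitive of w / b, w = psi (u_h - s), normalised as in
    normalizing_constant. The energy identity and the Cauchy-Schwarz inequality
    bound the square of the norm of w by that of u - u_h times that of
    b (psi v)', and
      norm (psi v)' <= norm v' + (sup |psi'|) norm v
                    <= (1 + C (d - c) sup |psi'|) norm v'.
    Since b v' = w, one factor norm w cancels. The polynomials h, s, u, F,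
    indexed by 1 and 2, are the two pieces of psi, s, u_h and psi f. *)
Lemma patch_estimate l c m d r b k C f u uh s psi
    (h1 h2 s1 s2 u1 u2 F1 F2 : {poly R}) :
  let D : set R := `]c, d[%classic in
  b != 0 -> l <= c -> c <= m -> m <= d -> d <= r -> c < d ->
  L2 `]l, r[ f -> L2 `]l, r[ u ->
  (forall v, H1_outflow b l r v ->
     - inner `]l, r[ u (fun y => b * grad `]l, r[ v y) = inner `]l, r[ f v) ->
  h1.[m] = h2.[m] -> s1.[m] = s2.[m] ->
  (size h1 <= 2)%N -> (size h2 <= 2)%N ->
  (size s1 <= k.+1)%N -> (size s2 <= k.+1)%N ->
  (size u1 <= k.+1)%N -> (size u2 <= k.+1)%N ->
  (size F1 <= k.+1)%N -> (size F2 <= k.+1)%N ->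
  {in D, psi =1 splice m h1 h2} -> (forall y, D y -> `|psi y| <= 1) ->
  h1.[c] = 0 \/ (c = m /\ c = l) -> h2.[d] = 0 \/ (d = m /\ d = r) ->
  measurable_fun D s -> s = splice m s1 s2 %[ae mu in D] ->
  measurable_fun D uh -> uh = splice m u1 u2 %[ae mu in D] ->
  measurable_fun D (fun y => psi y * f y) ->
  (fun y => psi y * f y) = splice m F1 F2 %[ae mu in D] ->
  (~ outflow b l r m ->
    inner D f psi + inner D uh (fun y => b * grad D psi y) = 0) ->
  (forall z1 z2 : {poly R}, (size z1 <= k.+1)%N -> (size z2 <= k.+1)%N ->
    inner D (fun y => b * grad D (fun z => psi z * s z) y) (splice m z1 z2) =
    inner D (fun y => f y * psi y + b * grad D psi y * uh y) (splice m z1 z2)) ->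
  0 < C ->
  (forall v,
     (~ outflow b l r m -> H1 D v /\ inner D v (cst 1) = 0) /\
     (outflow b l r m -> H1_outflow b c d v) ->
     norm2 D v <= (d - c) * C * norm2 D (grad D v)) ->
  L2 D (fun y => psi y * (uh y - s y)) /\
  norm2 D (fun y => psi y * (uh y - s y)) <=
  (1 + C * (d - c) * normoo D (grad D psi)) * norm2 D (fun y => u y - uh y).
Proof.
move=> D b0 lc cm md dr cd lf lu usol h12 s12 sh1 sh2 ss1 ss2 su1 su2 sF1 sF2.
move=> psiE psi1 hl hr ms sE muh uE mF FE orth ssol C0 PF.
have mD : measurable D by exact: measurable_itv.
have Ls := @L2_splice R c d m.
have E0 := strong_local_equation cm md h12 s12 sh1 sh2 ss1 ss2 su1 su2 sF1 sF2 psiE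
  ms sE muh uE mF FE ssol.
have mpsi : measurable_fun D psi.
  by apply: L2_measurable => //; apply: eq_L2 (Ls h1 h2) => y /psiE ->.
have psi_ae : psi = splice m h1 h2 %[ae mu in D].
  by apply: aeW => y yD; rewrite psiE ?inE.
have [_ lgpsi gpsi] := H1_ae_splice cm md h12 mpsi psi_ae.
have DO : D `<=` (`]l, r[ : set R).
  by move=> x; rewrite /D /= !in_itv /=; lra.
have lfD : L2 D f by apply: L2S lf => //; exact: measurable_itv.
have luD : L2 D u by apply: L2S lu => //; exact: measurable_itv.
have luh : L2 D uh := L2_ae_splice muh uE.
pose w1 := h1 * (u1 - s1); pose w2 := h2 * (u2 - s2).
have wE : (fun y => psi y * (uh y - s y)) = splice m w1 w2 %[ae mu in D].
  apply: ae_imply2 uE sE => y e1 e2 Dy.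
  by rewrite e1// e2// psiE ?inE// spliceB spliceM.
have mw : measurable_fun D (fun y => psi y * (uh y - s y)).
  by apply: measurable_funM => //; exact: measurable_funB.
have lw := L2_ae_splice mw wE.
split=> //.
rewrite (norm2_ae mD lw (Ls w1 w2) wE).
have [V1 [V1' V1m]] := poly_primitive (b^-1 *: w1) m.
have [V2 [V2' V2m]] := poly_primitive (b^-1 *: w2) m.
have [kap [kapO kapnO]] := normalizing_constant (outflow b l r m) m V1 V2 cd.
pose v1 := V1 - kap%:P; pose v2 := V2 - kap%:P.
have v12 : v1.[m] = v2.[m] by rewrite !hornerE V1m V2m.
have v1' : v1^`() = b^-1 *: w1 by rewrite derivB derivC subr0.
have v2' : v2^`() = b^-1 *: w2 by rewrite derivB derivC subr0.
have vw1 : b *: v1^`() = w1 by rewrite v1' scalerA divff// scale1r.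
have vw2 : b *: v2^`() = w2 by rewrite v2' scalerA divff// scale1r.
have vO : outflow b l r m -> v1.[m] = 0.
  by move=> /kapO e; rewrite !hornerE V1m e subrr.
(* Away from the outflow boundary, integrating the strong local equation
   against 1 shows that h s takes equal values at both ends of the patch; since
   the hat function vanishes at one of them, both values are zero. *)
have nbc : ~ outflow b l r m -> (h1 * s1).[c] = 0 /\ (h2 * s2).[d] = 0.
  move=> nO.
  have hsE : (h2 * s2).[d] - (h1 * s1).[c] = 0.
    rewrite -(Rintegral_splice cm md); last by rewrite !hornerM h12 s12.
    apply: (mulfI b0); rewrite mulr0 -RintegralZl//; last exact: L2_integrable (Ls _ _).
    have lFu := Ls (F1 + b *: (h1^`() * u1)) (F2 + b *: (h2^`() * u2)).
    transitivity (\int[mu]_(x in D) splice m (F1 + b *: (h1^`() * u1)) (F2 + b *: (h2^`() * u2)) x).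
      apply: Rintegral_ae => //.
      - exact: L2_measurable (L2Z _ mD (Ls _ _)).
      - exact: L2_measurable lFu.
      apply: ae_imply E0 => y e Dy; apply/eqP; rewrite -subr_eq0 spliceZ spliceB.
      by rewrite !opprD !addrA; apply/eqP; exact: e.
    rewrite -[RHS](orth nO) /inner -RintegralD//.
    - apply: Rintegral_ae => //; first exact: L2_measurable lFu.
        apply: measurable_funD; apply: measurable_funM => //; try exact: L2_measurable.
        by apply: measurable_funM => //; exact: L2_measurable.
      have both : \forall y \ae mu, D y -> grad D psi y = splice m h1^`() h2^`() y /\
          uh y = splice m u1 u2 y.
        by apply: ae_imply2 gpsi uE => y e1 e2 Dy; rewrite e1// e2.
      apply: ae_imply2 FE both => y eF eq Dy; have [eg eu] := eq Dy.
      by rewrite eg eu (mulrC (f y)) eF// [splice m u1 u2 y * _]mulrC -mulrA spliceM spliceZ spliceD.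
    - apply: L2_mul_integrable => //; apply: eq_L2 (Ls h1 h2) => y yD.
      by rewrite psiE.
    - by apply: L2_mul_integrable => //; exact: L2Z.
  have {}hsE : (h2 * s2).[d] = (h1 * s1).[c] by apply/eqP; rewrite -subr_eq0 hsE.
  case: hl => [hl|[cm' _]].
    have e : (h1 * s1).[c] = 0 by rewrite hornerM hl mul0r.
    by rewrite hsE e.
  case: hr => [hr|[dm' _]].
    have e : (h2 * s2).[d] = 0 by rewrite hornerM hr mul0r.
    by rewrite -hsE e.
  by move: cd; rewrite cm' dm' ltxx.
have bc : (h1 * s1 * v1).[c] = 0.
  rewrite hornerM; have [isO|nO] := pselect (outflow b l r m).
    case: hl => [hl|[-> _]]; first by rewrite hornerM hl !mul0r.
    by rewrite vO// mulr0.
  by rewrite (nbc nO).1 mul0r.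
have bd : (h2 * s2 * v2).[d] = 0.
  rewrite hornerM; have [isO|nO] := pselect (outflow b l r m).
    case: hr => [hr|[-> _]]; first by rewrite hornerM hr !mul0r.
    by rewrite -v12 vO// mulr0.
  by rewrite (nbc nO).2 mul0r.
have testE : - inner D u (fun y => b * splice m (h1 * v1)^`() (h2 * v2)^`() y) =
    inner D (splice m F1 F2) (splice m v1 v2).
  rewrite (test_function (b := b) (f := f) lc cm md dr) //; last 5 first.
  - lra.
  - by rewrite !hornerM h12 v12.
  - by case: hl => [hl|hl]; [left; rewrite hornerM hl mul0r|right].
  - by case: hr => [hr|hr]; [left; rewrite hornerM hr mul0r|right].
  - by move=> /vO e; rewrite hornerM e mulr0.
  apply: Rintegral_ae => //.
  - by apply: measurable_funM; exact: L2_measurable.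
  - by apply: measurable_funM; exact: L2_measurable.
  apply: ae_imply FE => y e Dy; rewrite -spliceM -e// psiE ?inE//.
  by rewrite mulrA (mulrC (f y)).
have energy := energy_identity cm md h12 s12 v12 vw1 vw2 erefl erefl luD E0 bc bd testE.
set N := norm2 D (splice m w1 w2).
set M := normoo D (grad D psi).
set e := norm2 D (fun y => u y - uh y).
have M0 : 0 <= M := normoo_ge0 _ _.
have N0 : 0 <= N := norm2_ge0 _ _.
have e0 : 0 <= e := norm2_ge0 _ _.
have Nv : N = `|b| * norm2 D (splice m v1^`() v2^`()).
  rewrite -norm2Z//; congr norm2; apply/funext => y.
  by rewrite spliceZ vw1 vw2.
have vH : H1 D (splice m v1 v2) /\
    norm2 D (grad D (splice m v1 v2)) = norm2 D (splice m v1^`() v2^`()).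
  have [H1v lgv gv] := H1_ae_splice cm md v12 (L2_measurable mD (Ls v1 v2)) (aeW _ (fun _ _ => erefl)).
  split=> //; exact: norm2_ae.
have vbound : norm2 D (splice m v1 v2) <= (d - c) * C * norm2 D (splice m v1^`() v2^`()).
  rewrite -vH.2; apply: PF; split=> [nO|O].
    by split; [exact: vH.1|exact: kapnO].
  split; first exact: vH.1.
  exists (splice m v1 v2); split.
  - by apply: continuous_subspaceT; exact: splice_continuous.
  - exact: aeW.
  - move=> x /(outflow_ends lc cm md dr cd O) ->.
    by rewrite splice_left// vO.
have hM : \forall y \ae mu, D y -> `|splice m h1^`() h2^`() y| <= M.
  have [a1 a1E] := deriv_affine sh1; have [a2 a2E] := deriv_affine sh2.
  have gb : \forall y \ae mu, D y -> `|grad D psi y| <= `|a1| + `|a2|.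
    apply: ae_imply gpsi => y g Dy; rewrite g// a1E a2E /splice !hornerC.
    by case: ifP => _; rewrite ?lerDl ?lerDr.
  by apply: ae_imply2 gpsi (normoo_ae mD gb) => y g h Dy; rewrite -g// h.
have zbound : norm2 D (splice m (h1 * v1)^`() (h2 * v2)^`()) <=
    (1 + C * (d - c) * M) * norm2 D (splice m v1^`() v2^`()).
  have l1 := Ls (h1^`() * v1) (h2^`() * v2); have l2 := Ls (h1 * v1^`()) (h2 * v2^`()).
  have -> : splice m (h1 * v1)^`() (h2 * v2)^`() =
      fun y => splice m (h1^`() * v1) (h2^`() * v2) y + splice m (h1 * v1^`()) (h2 * v2^`()) y.
    by apply/funext => y; rewrite spliceD !derivM.
  apply: (le_trans (norm2_triangle mD l1 l2)).
  have b1 : norm2 D (splice m (h1^`() * v1) (h2^`() * v2)) <= M * norm2 D (splice m v1 v2).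
    apply: norm2_le_ae => //; apply: ae_imply hM => y h Dy.
    by rewrite -spliceM normrM ler_wpM2r// h.
  have b2 : norm2 D (splice m (h1 * v1^`()) (h2 * v2^`())) <= 1 * norm2 D (splice m v1^`() v2^`()).
    apply: norm2_le_ae => //; apply: aeW => y Dy.
    by rewrite -spliceM normrM ler_wpM2r// -psiE ?inE// psi1.
  have b3 := ler_wpM2l M0 vbound.
  apply: (le_trans (lerD (le_trans b1 b3) b2)); rewrite le_eqVlt; apply/orP; left.
  by apply/eqP; ring.
have eE : norm2 D (fun y => splice m u1 u2 y - u y) = e.
  have le1 : L2 D (fun y => u y - uh y) by exact: L2B.
  have -> : e = norm2 D (fun y => -1 * (u y - uh y)) by rewrite norm2Z// normrN1 mul1r.
  apply: norm2_ae => //; [exact: L2B|exact: L2Z|].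
  by apply: ae_imply uE => y ue Dy /=; rewrite (ue Dy) mulN1r opprB.
have K0 : 0 <= 1 + C * (d - c) * M.
  by rewrite addr_ge0// !mulr_ge0// ?ltW// subr_gt0.
have N2 : N * N <= e * ((1 + C * (d - c) * M) * N).
  rewrite -[N * N]expr2 norm2_sqr energy -eE.
  apply: (le_trans (cauchy_schwarz mD _ _)); [exact: L2B|exact: L2Z|].
  rewrite norm2Z// ler_wpM2l ?norm2_ge0// Nv mulrCA ler_wpM2l//.
have [->|Nn0] := eqVneq N 0; first exact: mulr_ge0.
have Npos : 0 < N by rewrite lt_neqAle eq_sym Nn0.
rewrite -(ler_pM2r Npos); apply: (le_trans N2).
by rewrite mulrA [e * _]mulrC.
Qed.

End Patch.


(** * Hat functions and patches of a mesh *)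

Section MeshGeometry.
Context {R : realType} {l r kappa : R} (T : mesh l r kappa).
Implicit Types (a i j k : nat) (v g : R -> R).
Local Notation mu := (@lebesgue_measure R).
Local Notation N := (mesh_size T).
Local Notation x := (vertex T).

Lemma vertex_ltn i j : (i < j)%N -> (j <= N)%N -> x i < x j.
Proof.
elim: j => [//|j IH]; rewrite ltnS leq_eqVlt => /predU1P[->|ij] jN.
  exact: vertex_lt.
exact: lt_trans (IH ij (ltnW jN)) (vertex_lt jN).
Qed.

Lemma vertex_le i j : (i <= j)%N -> (j <= N)%N -> x i <= x j.
Proof.
by rewrite leq_eqVlt => /predU1P[->//|ij] jN; exact/ltW/vertex_ltn.
Qed.

Lemma vertex_ge_l a : (a <= N)%N -> l <= x a.
Proof. by move=> aN; have := vertex_le (leq0n a) aN; rewrite vertex_first. Qed.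

Lemma vertex_le_r a : (a <= N)%N -> x a <= r.
Proof. by move=> aN; have := vertex_le aN (leqnn N); rewrite vertex_last. Qed.

Lemma patch_left_le a : (a <= N)%N -> patch_left T a <= x a.
Proof. by move=> aN; apply: vertex_le => //; exact: leq_pred. Qed.

Lemma patch_right_ge a : (a <= N)%N -> x a <= patch_right T a.
Proof. by move=> aN; apply: vertex_le; rewrite ?geq_minr// leq_min leqnSn. Qed.

Lemma patch_right_interior a : (a < N)%N -> patch_right T a = x a.+1.
Proof. by move=> aN; rewrite /patch_right (minn_idPl aN). Qed.

Lemma patch_right_last : patch_right T N = x N.
Proof. by rewrite /patch_right (minn_idPr (leqnSn N)). Qed.

Lemma patch_lt a : (a <= N)%N -> patch_left T a < patch_right T a.
Proof.
move=> aN; apply: vertex_ltn; last exact: geq_minr.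
have := mesh_size_gt0 T; rewrite leq_min; lia.
Qed.

(** The values 1 at the boundary vertices belong to the empty side of a
    one-element patch; they make the two pieces agree at every vertex. *)
Definition hat_left a : {poly R} :=
  if (0 < a)%N then (x a - x a.-1)^-1 *: ('X - (x a.-1)%:P) else 1.

Definition hat_right a : {poly R} :=
  if (a < N)%N then (x a.+1 - x a)^-1 *: ((x a.+1)%:P - 'X) else 1.

Lemma hat_left1 a : (a <= N)%N -> (hat_left a).[x a] = 1.
Proof.
rewrite /hat_left; case: ltnP => a0 aN; last by rewrite hornerE.
by rewrite !hornerE mulVf// subr_eq0 gt_eqF// vertex_ltn//; lia.
Qed.

Lemma hat_right1 a : (a <= N)%N -> (hat_right a).[x a] = 1.
Proof.
rewrite /hat_right; case: ltnP => a0 aN; last by rewrite hornerE.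
by rewrite !hornerE mulVf// subr_eq0 gt_eqF// vertex_ltn.
Qed.

Lemma size_hat_left a : (size (hat_left a) <= 2)%N.
Proof.
rewrite /hat_left; case: ifP => _; last by rewrite size_poly1.
by rewrite (leq_trans (size_scale_leq _ _))// size_XsubC.
Qed.

Lemma size_hat_right a : (size (hat_right a) <= 2)%N.
Proof.
rewrite /hat_right; case: ifP => _; last by rewrite size_poly1.
by rewrite (leq_trans (size_scale_leq _ _))// -size_polyN opprB size_XsubC.
Qed.

Lemma hat_left_end a : (hat_left a).[patch_left T a] = 0 \/
  (patch_left T a = x a /\ patch_left T a = l).
Proof.
rewrite /hat_left /patch_left; case: ltnP => a0; first by left; rewrite !hornerE subrr mulr0.
by right; move: a0; rewrite leqn0 => /eqP -> /=; rewrite vertex_first.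
Qed.

Lemma hat_right_end a : (a <= N)%N -> (hat_right a).[patch_right T a] = 0 \/
  (patch_right T a = x a /\ patch_right T a = r).
Proof.
rewrite /hat_right leq_eqVlt => /predU1P[->|aN].
  by right; rewrite patch_right_last vertex_last.
by left; rewrite aN patch_right_interior// !hornerE subrr mulr0.
Qed.

Lemma hat_spliceE a : (a <= N)%N ->
  {in omega T a, hat T a =1 splice (x a) (hat_left a) (hat_right a)}.
Proof.
move=> aN y; rewrite inE /omega /= in_itv /= => /andP[cy yd].
case: (leP y (x a)) => ya.
  rewrite splice_left// /hat /hat_left ya (ltW cy).
  case: ltnP => [a0|] /=; first by rewrite !hornerE mulrC.
  rewrite leqn0 => /eqP a0; move: cy ya; rewrite a0 /patch_left /= => h1 h2.
  by move: (lt_le_trans h1 h2); rewrite ltxx.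
rewrite splice_right// /hat /hat_right (leNgt y) ya !andbF (ltW ya).
move: aN; rewrite leq_eqVlt => /predU1P[a_N|aN].
  by move: yd; rewrite a_N patch_right_last -a_N => /(lt_trans ya); rewrite ltxx.
by rewrite aN /= -patch_right_interior// (ltW yd) !hornerE mulrC.
Qed.

Lemma hat_le1 a y : (a <= N)%N -> `|hat T a y| <= 1.
Proof.
move=> aN; rewrite /hat; case: ifPn => [/andP[a0 /andP[y1 y2]]|_].
  have h : 0 < x a - x a.-1 by rewrite subr_gt0 vertex_ltn//; lia.
  rewrite ger0_norm; last by rewrite divr_ge0 ?subr_ge0// -subr_ge0 ltW.
  by rewrite ler_pdivrMr// mul1r lerB.
case: ifPn => [/andP[a1 /andP[y1 y2]]|_]; last by rewrite normr0.
have h : 0 < x a.+1 - x a by rewrite subr_gt0 vertex_ltn.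
rewrite ger0_norm; last by rewrite divr_ge0 ?subr_ge0// -subr_ge0 ltW.
by rewrite ler_pdivrMr// mul1r lerB.
Qed.

(** On the one-element patches of the boundary vertices both pieces are the
    polynomial of that element, so that they agree at the vertex there too. *)
Lemma patch_pw_poly a k v : (a <= N)%N -> pw_poly T (elements_at T a) k v ->
  measurable_fun (omega T a) v /\
  exists p1 p2 : {poly R}, [/\ (size p1 <= k.+1)%N, (size p2 <= k.+1)%N,
    v = splice (x a) p1 p2 %[ae mu in omega T a] &
    ~~ (0 < a < N)%N -> p1 = p2].
Proof.
move=> aN vP.
have splice_same (p : {poly R}) y : splice (x a) p p y = p.[y] by rewrite /splice if_same.
have [a0|a0] := posnP a.
  have E0 : elements_at T a 0 by split; [exact: mesh_size_gt0|left].
  have omE : omega T a = element T 0.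
    rewrite /omega /element a0 /patch_left /= patch_right_interior//.
    exact: mesh_size_gt0.
  have [mv [p [sp vp]]] := vP _ E0.
  rewrite omE; split=> //; exists p, p; split=> //.
  by apply: ae_imply vp => y + Dy; rewrite splice_same; exact.
have [a_N|a_N] := eqVneq a N.
  have E0 : elements_at T a a.-1 by split; [lia|right; lia].
  have omE : omega T a = element T a.-1.
    by rewrite /omega /element /patch_left {2}a_N patch_right_last prednK// -a_N.
  have [mv [p [sp vp]]] := vP _ E0.
  rewrite omE; split=> //; exists p, p; split=> //.
  by apply: ae_imply vp => y + Dy; rewrite splice_same; exact.
have {aN a_N} aN : (a < N)%N by lia.
have E1 : elements_at T a a.-1 by split; [lia|right; lia].
have E2 : elements_at T a a by split; [|left].
have [mv1 [p1 [sp1 vp1]]] := vP _ E1; have [mv2 [p2 [sp2 vp2]]] := vP _ E2.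
have cm : x a.-1 < x a by apply: vertex_ltn; lia.
have md : x a < x a.+1 by exact: vertex_ltn.
have el1 : element T a.-1 = `]x a.-1, x a[%classic by rewrite /element prednK.
have omE : omega T a = (`]x a.-1, x a[ `|` [set x a]) `|` `]x a, x a.+1[.
  by rewrite /omega /patch_left patch_right_interior//; exact: itv_split.
split.
  rewrite omE; apply/measurable_funU => //; first exact: measurableU.
  split=> //; apply/measurable_funU => //; split; last exact: measurable_fun_set1.
  by rewrite -el1.
exists p1, p2; split=> //; last by rewrite aN.
have both : \forall y \ae mu, (element T a.-1 y -> v y = p1.[y]) /\
    (element T a y -> v y = p2.[y]) by apply: ae_imply2 vp1 vp2.
apply: ae_imply2 both (ae_neq (x a)) => y [e1 e2] ym; rewrite omE.
move=> [[h|e]|h]; last 2 first.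
- by move: ym; rewrite e eqxx.
- by rewrite e2// splice_right//; move: h; rewrite /= in_itv /= => /andP[].
rewrite e1; last by rewrite el1.
by rewrite splice_left// ltW//; move: h; rewrite /= in_itv /= => /andP[].
Qed.

Lemma pw_poly_splice a k (z1 z2 : {poly R}) : (a <= N)%N ->
  (size z1 <= k.+1)%N -> (size z2 <= k.+1)%N ->
  pw_poly T (elements_at T a) k (splice (x a) z1 z2).
Proof.
move=> aN s1 s2 i [iN ia]; split.
  by apply: L2_measurable; [exact: measurable_itv|exact: L2_splice].
case: ia => [ia|ia].
  exists z2; split=> //; apply: aeW => y; rewrite ia /element /= in_itv /=.
  by move=> /andP[ay _]; rewrite splice_right.
exists z1; split=> //; apply: aeW => y; rewrite -ia /element /= in_itv /=.
by move=> /andP[_ ya]; rewrite splice_left// ltW.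
Qed.

Lemma pw_poly_le (E : set nat) k k' v : (k <= k')%N ->
  pw_poly T E k v -> pw_poly T E k' v.
Proof.
move=> kk vP i Ei; have [mv [p [sp vp]]] := vP i Ei.
by split=> //; exists p; split=> //; rewrite (leq_trans sp).
Qed.

Lemma pw_poly_sub (E F : set nat) k v : F `<=` E ->
  pw_poly T E k v -> pw_poly T F k v.
Proof. by move=> FE vP i /FE; exact: vP. Qed.

Lemma not_outflow b a : b != 0 -> (a <= N)%N -> ~ outflow b l r (x a) ->
  interior_vertex T a \/ inflow_vertex T b a.
Proof.
move=> b0 aN nO; rewrite /interior_vertex.
have [aint|aext] := boolP (0 < a < N)%N; [by left|right].
have alr : x a = l \/ x a = r.
  have [->|a0] := posnP a; first by left; exact: vertex_first.
  right; have -> : a = N by lia.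
  exact: vertex_last.
split=> //; rewrite mulNr oppr_gt0 ltNge le_eqVlt.
apply/negP => /orP[|h]; last by apply: nO; split.
by rewrite eq_sym mulf_eq0 (negbTE b0) /normal; case: ifP => _; rewrite ?oppr_eq0 oner_eq0.
Qed.

Lemma L2_pw_poly k v : pw_poly T (elements T) k v ->
  forall i, (i < N)%N -> L2 (element T i) v.
Proof.
move=> vP i iN; have [mv [p [_ vp]]] := vP i iN.
by apply: (L2_ae _ mv vp); [exact: measurable_itv|exact: L2_poly].
Qed.

Lemma L2_mesh g : (forall i, (i < N)%N -> L2 (element T i) g) ->
  L2 `]l, r[ g /\ inner `]l, r[ g g = \sum_(i < N) inner (element T i) g g.
Proof.
move=> Lg.
suff H n : (n <= N)%N -> L2 `]x 0, x n[ g /\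
    inner `]x 0, x n[ g g = \sum_(i < n) inner (element T i) g g.
  by have := H N (leqnn N); rewrite vertex_first vertex_last.
elim: n => [_|n IH nN].
  rewrite big_ord0 /inner set_itvoo0 ?Rintegral_set0 -?leNgt//; split=> //.
  by apply: L2I => //; [exact: measurable_fun_set0|exact: integrable_set0].
have [L1 I1] := IH (ltnW nN).
have le1 : x 0 <= x n by apply: vertex_le => //; exact: ltnW.
have le2 : x n <= x n.+1 by exact: vertex_le.
have L2g := L2_split le1 le2 L1 (Lg n nN).
by split=> //; rewrite (inner_split le1 le2 L2g L2g) I1 big_ord_recr.
Qed.

(** One of the two terms is absent at each boundary vertex. *)
Lemma inner_patch a g : (a <= N)%N -> L2 (omega T a) g ->
  inner (omega T a) g g =
  (if (0 < a)%N then inner (element T a.-1) g g else 0) +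
  (if (a < N)%N then inner (element T a) g g else 0).
Proof.
move=> aN Lg; rewrite /omega.
rewrite (inner_split (patch_left_le aN) (patch_right_ge aN) Lg Lg).
have empty c : inner `]c, c[ g g = 0.
  by rewrite /inner set_itvoo0 ?Rintegral_set0// -leNgt.
congr (_ + _).
  rewrite /element /patch_left; case: ltnP => [a0|]; first by rewrite prednK.
  by rewrite leqn0 => /eqP ->; rewrite empty.
move: aN; rewrite leq_eqVlt => /predU1P[->|aN].
  by rewrite ltnn patch_right_last empty.
by rewrite aN patch_right_interior.
Qed.

Lemma element_sub_omega a i : (i < N)%N -> (i = a \/ i.+1 = a) ->
  element T i `<=` omega T a.
Proof.
move=> iN ia y; rewrite /element /omega /= !in_itv /= => /andP[h1 h2].
case: ia => [<-|<-].
  rewrite patch_right_interior// h2 andbT (le_lt_trans _ h1)//.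
  exact: patch_left_le (ltnW iN).
by rewrite {1}/patch_left /= h1 (lt_le_trans h2)// patch_right_ge.
Qed.

Lemma omega_element a i y : (a <= N)%N -> (i < N)%N -> element T i y ->
  omega T a y -> i = a \/ i.+1 = a.
Proof.
move=> aN iN; rewrite /element /omega /= !in_itv /= => /andP[h1 h2] /andP[h3 h4].
have : ~ (a < i)%N.
  move=> ai; have := lt_trans h1 h4; rewrite patch_right_interior; last lia.
  by rewrite ltNge vertex_le//; lia.
have : ~ (i.+1 < a)%N.
  by move=> ai; have := lt_trans h3 h2; rewrite ltNge /patch_left vertex_le//; lia.
lia.
Qed.

Lemma hat_partition i y : (i < N)%N -> element T i y ->
  hat T i y + hat T i.+1 y = 1.
Proof.
move=> iN; rewrite /element /= in_itv /= => /andP[h1 h2].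
rewrite /hat (leNgt y (x i)) h1 !andbF iN (ltW h1) (ltW h2) /=.
rewrite -mulrDl addrA subrK divff// subr_eq0 gt_eqF//; exact: vertex_lt.
Qed.

Lemma reconstruction_element (s : 'I_N.+1 -> R -> R) i y :
  (i < N)%N -> element T i y ->
  reconstruction s y =
  hat T i y * s (inord i) y + hat T i.+1 y * s (inord i.+1) y.
Proof.
move=> iN iy; rewrite /reconstruction.
have e1 : (inord i : 'I_N.+1) = i :> nat by rewrite inordK// ltnS ltnW.
have e2 : (inord i.+1 : 'I_N.+1) = i.+1 :> nat by rewrite inordK.
have neq : (inord i.+1 : 'I_N.+1) != inord i.
  by rewrite -val_eqE /= e1 e2; lia.
rewrite (bigD1 (inord i))//= (bigD1 (inord i.+1))//= big1; last first.
  move=> a /andP[ai ai1]; rewrite patchE memNset// => /(omega_element _ iN iy).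
  have := ltn_ord a; rewrite ltnS => aN /(_ aN) [ia|ia].
    by move: ai; rewrite -val_eqE /= e1 ia eqxx.
  by move: ai1; rewrite -val_eqE /= e2 ia eqxx.
rewrite addr0 !patchE !mem_set ?e1 ?e2//.
- by apply: (element_sub_omega iN _ iy); right.
- by apply: (element_sub_omega iN _ iy); left.
Qed.

End MeshGeometry.

(** * Summation over the patches *)

(** Each element lies in the patches of exactly its two end points. *)
Lemma sum_patches (R : realType) (n : nat) (P : nat -> nat -> R) :
  \sum_(a < n.+1) ((if (0 < a)%N then P a a.-1 else 0) +
                   (if (a < n)%N then P a a else 0)) =
  \sum_(i < n) (P i.+1 i + P i i).
Proof.
rewrite !big_split /=; congr (_ + _).
  by rewrite big_ord_recl /= add0r; apply: eq_bigr.
rewrite big_ord_recr /= ltnn addr0; apply: eq_bigr => i _ /=.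
by rewrite ltn_ord.
Qed.

Lemma inner_sqrD_le (R : realType) (D : set R) (f g : R -> R) :
  measurable D -> L2 D f -> L2 D g ->
  inner D (fun y => f y + g y) (fun y => f y + g y) <=
  2 * (inner D f f + inner D g g).
Proof.
move=> mD lf lg; rewrite -!norm2_sqr.
have := norm2_triangle mD lf lg; have := norm2_ge0 D (fun y => f y + g y).
have := sqr_ge0 (norm2 D f - norm2 D g).
move: (norm2 D f) (norm2 D g) (norm2 D _) => A B E.
by nra.
Qed.

Theorem lemma7p2 (R : realType) (l r b kappa : R) (hlr : l < r) (hb : b != 0)
  (f : R -> R) (hf : L2 `]l, r[ f)
  (Th : mesh l r kappa)
  (CPF : 'I_(mesh_size Th).+1 -> R)
  (hCPF : forall a : 'I_(mesh_size Th).+1, PF_constant Th b a (CPF a))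
  (u : R -> R) (hu : L2 `]l, r[ u)
  (hu_sol : forall v, H1_outflow b l r v ->
     - inner `]l, r[ u (fun y => b * grad `]l, r[ v y) = inner `]l, r[ f v)
  (k : nat) (uh : R -> R) (huh : pw_poly Th (elements Th) k uh)
  (huh_orth : forall a : 'I_(mesh_size Th).+1,
     interior_vertex Th a \/ inflow_vertex Th b a ->
     inner (omega Th a) f (hat Th a) +
     inner (omega Th a) uh (fun y => b * grad (omega Th a) (hat Th a) y) = 0)
  (k' : nat) (hk : (k <= k')%N)
  (s : 'I_(mesh_size Th).+1 -> R -> R)
  (hs : forall a : 'I_(mesh_size Th).+1,
     pw_poly Th (elements_at Th a) k' (s a) /\ H1 (omega Th a) (s a))
  (hs_sol : forall (a : 'I_(mesh_size Th).+1) (vh : R -> R),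
     pw_poly Th (elements_at Th a) k' vh ->
     inner (omega Th a)
       (fun y => b * grad (omega Th a) (fun z => hat Th a z * s a z) y) vh =
     inner (omega Th a)
       (fun y => f y * hat Th a y + b * grad (omega Th a) (hat Th a) y * uh y) vh)
  (hf_poly : forall a : 'I_(mesh_size Th).+1,
     pw_poly Th (elements_at Th a) k' (fun y => hat Th a y * f y)) :
  norm2 `]l, r[ (fun y => uh y - reconstruction s y) <=
  2 * C_contPF CPF * norm2 `]l, r[ (fun y => u y - uh y).
Proof.
set N := mesh_size Th.
have b0 := hb; pose K := C_contPF CPF.
pose w (a : 'I_N.+1) y := hat Th a y * (uh y - s a y).
(* wn is indexed by natural numbers, to be evaluated at i and i.+1 *)
pose wn (a : nat) := w (inord a).
pose eps y := u y - uh y.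
have KaK (a : 'I_N.+1) : 1 + CPF a * patch_diam Th a *
    normoo (omega Th a) (grad (omega Th a) (hat Th a)) <= K.
  exact: (le_bigmax _ (fun a : 'I_N.+1 => 1 + CPF a * patch_diam Th a *
    normoo (omega Th a) (grad (omega Th a) (hat Th a))) a).
have K0 : 0 <= K.
  apply: le_trans (KaK ord0); rewrite addr_ge0// mulr_ge0 ?normoo_ge0//.
  rewrite mulr_ge0//; first by have [/ltW] := hCPF ord0.
  by rewrite subr_ge0 ltW// patch_lt.
have HP (a : 'I_N.+1) : L2 (omega Th a) (w a) /\
    norm2 (omega Th a) (w a) <= K * norm2 (omega Th a) eps.
  have aN : (a <= N)%N by rewrite -ltnS.
  have [Cpos PF] := hCPF a; have [sP sH1] := hs a.
  have [ms [s1 [s2 [ss1 ss2 sE sdeg]]]] := patch_pw_poly aN sP.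
  have uP : pw_poly Th (elements_at Th a) k' uh.
    by apply: pw_poly_le hk _; apply: pw_poly_sub huh => i [].
  have [muh [u1 [u2 [su1 su2 uE _]]]] := patch_pw_poly aN uP.
  have [mF [F1 [F2 [sF1 sF2 FE _]]]] := patch_pw_poly aN (hf_poly a).
  have s12 : s1.[vertex Th a] = s2.[vertex Th a].
    have [/andP[a0 a1]|aext] := boolP (0 < a < N)%N; last by rewrite sdeg.
    apply: (H1_no_jump _ _ sH1 sE).
      by apply: vertex_ltn => //; rewrite ltn_predL.
    by rewrite patch_right_interior//; apply: vertex_ltn.
  have h12 : (hat_left Th a).[vertex Th a] = (hat_right Th a).[vertex Th a].
    by rewrite hat_left1// hat_right1.
  have [||||lw nw] := @patch_estimate R l (patch_left Th a) (vertex Th a)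
    (patch_right Th a) r b k' (CPF a) f u uh (s a) (hat Th a)
    (hat_left Th a) (hat_right Th a) s1 s2 u1 u2 F1 F2 b0 _ (patch_left_le aN)
    (patch_right_ge aN) _ (patch_lt aN) hf hu hu_sol h12 s12
    (size_hat_left _ _) (size_hat_right _ _) ss1 ss2 su1 su2 sF1 sF2
    (hat_spliceE aN) (fun y _ => hat_le1 y aN) (hat_left_end _ _)
    (hat_right_end aN) ms sE muh uE mF FE _ _ Cpos PF.
  - by apply: vertex_ge_l; exact: leq_trans (leq_pred _) aN.
  - by apply: vertex_le_r; rewrite geq_minr.
  - by move=> nO; apply: huh_orth; exact: not_outflow nO.
  - by move=> z1 z2 sz1 sz2; apply: hs_sol; exact: pw_poly_splice.
  split=> //; apply: (le_trans nw); apply: ler_wpM2r; first exact: norm2_ge0.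
  exact: KaK.
have HPn (a : nat) : (a <= N)%N -> L2 (omega Th a) (wn a) /\
    norm2 (omega Th a) (wn a) <= K * norm2 (omega Th a) eps.
  by move=> aN; have := HP (inord a); rewrite inordK.
have mel i : measurable (element Th i) by exact: measurable_itv.
have Lw i : (i < N)%N -> L2 (element Th i) (wn i) /\ L2 (element Th i) (wn i.+1).
  move=> iN; split.
    apply: (L2S _ (mel i) _ (HPn i (ltnW iN)).1); first exact: measurable_itv.
    by apply: element_sub_omega => //; left.
  apply: (L2S _ (mel i) _ (HPn i.+1 iN).1); first exact: measurable_itv.
  by apply: element_sub_omega => //; right.
pose e y := uh y - reconstruction s y.
(* The two hat functions that live on an element sum to 1 there, which
   distributes u_h over the patches. *)
have eE i : (i < N)%N -> {in element Th i, (fun y => wn i y + wn i.+1 y) =1 e}.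
  move=> iN y; rewrite inE => iy; rewrite /e (reconstruction_element _ iN iy).
  rewrite /wn /w !inordK// ?ltnS ?(ltnW iN)//.
  rewrite -{3}[uh y]mul1r -(hat_partition iN iy); ring.
have Le i : (i < N)%N -> L2 (element Th i) e.
  by move=> iN; have [l1 l2] := Lw i iN; apply: eq_L2 (eE i iN) (L2D (mel i) l1 l2).
have [_ Ie] := L2_mesh Le.
have Luh := L2_mesh (L2_pw_poly huh).
have mO : measurable (`]l, r[%classic : set R) by exact: measurable_itv.
have Leps : L2 `]l, r[ eps by apply: L2B => //; exact: Luh.1.
have elO i : (i < N)%N -> element Th i `<=` `]l, r[.
  move=> iN y; rewrite /element /= !in_itv /= => /andP[h1 h2].
  rewrite (le_lt_trans _ h1) ?(lt_le_trans h2)//; first exact: vertex_le_r.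
  by apply: vertex_ge_l; exact: ltnW.
have Leps_el i : (i < N)%N -> L2 (element Th i) eps.
  by move=> iN; apply: L2S Leps => //; exact: elO.
have [_ Ieps] := L2_mesh Leps_el.
have Leps_om a : (a <= N)%N -> L2 (omega Th a) eps.
  move=> aN; apply: L2S Leps => //; first exact: measurable_itv.
  move=> y; rewrite /omega /= !in_itv /= => /andP[h1 h2].
  rewrite (le_lt_trans _ h1) ?(lt_le_trans h2)//.
    by apply: vertex_le_r; rewrite geq_minr.
  by apply: vertex_ge_l; exact: leq_trans (leq_pred _) aN.
(* One factor 2 comes from the two patch contributions on each element, by
   convexity of the square, the other one from counting each element in two
   patches. *)
have main : inner `]l, r[ e e <= 4 * K ^+ 2 * inner `]l, r[ eps eps.
  rewrite Ie.
  apply: (@le_trans _ _ (2 * \sum_(i < N)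
      (inner (element Th i) (wn i.+1) (wn i.+1) + inner (element Th i) (wn i) (wn i)))).
    rewrite mulr_sumr; apply: ler_sum => i _; have [l1 l2] := Lw i (ltn_ord i).
    rewrite -(eq_inner (eE i (ltn_ord i)) (eE i (ltn_ord i))) addrC.
    exact: inner_sqrD_le.
  rewrite -(sum_patches _ (fun a i => inner (element Th i) (wn a) (wn a))).
  apply: (@le_trans _ _ (2 * (K ^+ 2 * \sum_(a < N.+1) inner (omega Th a) eps eps))).
    rewrite ler_pM2l// mulr_sumr; apply: ler_sum => a _.
    have aN : (a <= N)%N by rewrite -ltnS.
    have [lw nw] := HPn a aN; rewrite -inner_patch// -!norm2_sqr -exprMn.
    by rewrite lerXn2r// ?nnegrE ?mulr_ge0 ?norm2_ge0.
  under eq_bigr => a _ do rewrite (inner_patch (ltn_ord a) (Leps_om a (ltn_ord a))).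
  rewrite (sum_patches _ (fun a i => inner (element Th i) eps eps)).
  rewrite big_split /= -Ieps le_eqVlt; apply/orP; left; apply/eqP; ring.
rewrite -ler_sqr ?nnegrE ?mulr_ge0 ?norm2_ge0//.
rewrite exprMn !norm2_sqr; apply: (le_trans main).
by rewrite exprMn -natrX.
Qed.
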